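(* Let $\alpha>0$ be a constant. There is a constant $C$ (depending only on $\alpha$) such that the following holds. Let $m,n,l$ be positive integers with $m\ge n+4$, $m-\alpha\log_2 m\ge n+2$ and $l+1+\log_2(l+1)\le 2^{m-n-2}$, and let $N=\max\{m,l\}$. Let $a$ be a binary string of length $m$ and $b$ a binary string of length $n$ with $$m+n-\mathrm{KS}^{\mathbf 0'}(a,b)<\alpha\log_2 m.$$ Then there exists a binary string $c$ such that (i) $|\mathrm{KS}(c)-(n+l)|\le C\log N$; (ii) $|\mathrm{KS}(c\mid b)-\mathrm{KS}(c)|\le C\log N$; (iii) $\mathrm{KS}(b\mid a,c)\le C\log N$; (iv) for every binary string $f$ with $\mathrm{KS}(f)\le l-\mathrm{KS}(b\mid a,f)$ we have $\mathrm{KS}(b\mid c,f)\le m-n+\mathrm{KS}(b\mid a,f)+C\log N$.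
   Context: $\mathrm{KS}(u)$ and $\mathrm{KS}(u\mid v)$ denote plain and conditional Kolmogorov complexity of binary strings with respect to a fixed optimal programming language; conditioning on two strings means conditioning on an encoding of the pair. $\mathrm{KS}^{\mathbf 0'}(a,b)$ denotes the Kolmogorov complexity of (an encoding of) the pair $\langle a,b\rangle$ relativized to the halting problem oracle $\mathbf 0'$. *)

(* Defs.v *)
From Stdlib Require Import Reals Lra Lia Arith List ClassicalEpsilon.
Open Scope R_scope.

Inductive instr : Type :=
| INC (r : nat)
| DEC (r j : nat)
| ORC (r : nat).

Definition prog := list instr.
Definition regs := nat -> nat.

Definition upd (R0 : regs) (r v : nat) : regs :=
  fun i => if Nat.eqb i r then v else R0 i.

Inductive step (O : nat -> Prop) (P : prog) : nat * regs -> nat * regs -> Prop :=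
| st_inc pc R0 r : nth_error P pc = Some (INC r) ->
    step O P (pc, R0) (S pc, upd R0 r (S (R0 r)))
| st_dec0 pc R0 r j : nth_error P pc = Some (DEC r j) -> R0 r = 0%nat ->
    step O P (pc, R0) (j, R0)
| st_decS pc R0 r j k : nth_error P pc = Some (DEC r j) -> R0 r = S k ->
    step O P (pc, R0) (S pc, upd R0 r k)
| st_orc1 pc R0 r : nth_error P pc = Some (ORC r) -> O (R0 r) ->
    step O P (pc, R0) (S pc, upd R0 r 1%nat)
| st_orc0 pc R0 r : nth_error P pc = Some (ORC r) -> ~ O (R0 r) ->
    step O P (pc, R0) (S pc, upd R0 r 0%nat).

Inductive steps (O : nat -> Prop) (P : prog) : nat * regs -> nat * regs -> Prop :=
| steps_refl c : steps O P c c
| steps_step c1 c2 c3 : step O P c1 c2 -> steps O P c2 c3 -> steps O P c1 c3.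

Definition init_regs (x : nat) : regs := fun i => if Nat.eqb i 0 then x else 0%nat.

Definition computes (O : nat -> Prop) (P : prog) (x y : nat) : Prop :=
  exists pc R0, steps O P (0%nat, init_regs x) (pc, R0) /\
    nth_error P pc = None /\ R0 0%nat = y.

(** bijective pairing nat*nat -> nat *)
Definition npair (a b : nat) : nat := (2 ^ a * (2 * b + 1) - 1)%nat.

(** bijective coding of binary strings by naturals (bijective base 2) *)
Fixpoint str_code (s : list bool) : nat :=
  match s with
  | nil => 0%nat
  | b :: t => (2 * str_code t + (if b then 2 else 1))%nat
  end.

Definition instr_code (i : instr) : nat :=
  match i with
  | INC r => (3 * r)%nat
  | DEC r j => (3 * npair r j + 1)%nat
  | ORC r => (3 * r + 2)%nat
  end.

Fixpoint prog_code (P : prog) : nat :=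
  match P with
  | nil => 0%nat
  | i :: t => S (npair (instr_code i) (prog_code t))
  end.

Definition no_oracle : nat -> Prop := fun _ => False.

Definition halting_set : nat -> Prop :=
  fun e => exists P, prog_code P = e /\ exists y, computes no_oracle P 0%nat y.

Fixpoint double_bits (u : list bool) : list bool :=
  match u with
  | nil => nil
  | b :: t => b :: b :: double_bits t
  end.

Definition str_pair (u v : list bool) : list bool :=
  double_bits u ++ false :: true :: v.

(** A conditional description mode: [D p y x] means "program p on condition y
    outputs x". *)
Definition cdecomp := list bool -> list bool -> list bool -> Prop.

Definition computable_cdecomp (O : nat -> Prop) (D : cdecomp) : Prop :=
  exists P : prog, forall p y x,
    D p y x <-> computes O P (npair (str_code p) (str_code y)) (str_code x).

Definition optimal (O : nat -> Prop) (U : cdecomp) : Prop :=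
  computable_cdecomp O U /\
  forall D, computable_cdecomp O D ->
    exists c : nat, forall p y x, D p y x ->
      exists q, U q y x /\ (length q <= length p + c)%nat.

Definition KSc (U : cdecomp) (x y : list bool) : nat :=
  epsilon (inhabits 0%nat)
    (fun k => (exists p, U p y x /\ length p = k) /\
              forall p, U p y x -> (k <= length p)%nat).

Definition KS (U : cdecomp) (x : list bool) : nat := KSc U x nil.

Definition log2 (x : R) : R := ln x / ln 2.

(* Main.v *)
(** Write [N = max(m, l)] and let [F_p(x)] be the set of at most [2^(k+1)] strings [y] that
    have complexity at most [k] given [x] and the output [f] of [p]. A random coloring of the
    pairs [(x, y)] by [2^n] colors meets every [F_p] in about [2^(m-n+k)] pairs of each color;
    then the color [i] of [(a, b)] together with [a] leaves few candidates for [b], and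
    together with [f] it leaves about [2^(m-n+k)] candidates. The sets [F_p] are only
    enumerable, so the coloring is chosen again whenever a fraction [N^-beta] of the pairs has
    become bad, i.e. their color is overfull in some [F_p], or the string [c] coding (number
    of the stage, color) has turned out to be compressible given [y]. Every stage consumes a
    fixed share of a bounded resource (points newly entering the [F_p], short programs), hence
    there are at most [2^l N^O(1)] stages, and [c] has length [n + l + O(log N)]. The oracle
    [0'] finds the last stage and enumerates its bad pairs, so [(a, b)] is not one of them:
    otherwise its complexity relative to [0'] would be too small. *)

Require Import Defs.
From Stdlib Require Import Reals Lra Lia Arith List ClassicalEpsilon.
From Stdlib Require Import FunctionalExtensionality Cantor Classical Bool.
Open Scope nat_scope.

(** * Counter machines *)

(** The random coloring is replaced by a greedy choice along a potential. Once a balanced coloring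
    is known to exist, the least one can be found by exhaustive search, so a decoder that is told
    [m], [n], [l] and [g] can rerun the whole game; the string c then has to carry only the number
    of the stage and a color. The constants are shaped by a circle. The [g] bits saved in describing
    a bad point, where [2^-g] is the tolerated fraction, must outweigh the cost of the parameters of
    the game, and [g] is one of them. It is broken because naming [g] costs only about log [g] bits:
    a large enough constant multiple of log N will do. A restart must be expensive. Two kinds of
    static tests, the lines with x fixed and with y fixed, keep color classes small, so that many
    bad points require many dead colors or many compressible codes. Since complexity is defined by
    concrete counter machines, every algorithm is brought to one form: an unbounded search for the
    least witness of a primitive recursive condition. *)

Inductive cmd : Type :=
| Cskip
| Cinc (r : nat)
| Corc (r : nat)
| Cseq (c d : cmd)
| Cif (r : nat) (c d : cmd)
| Cloop (r : nat) (c : cmd).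

(** Tests are made by the instruction [DEC], so the first branch of [Cif] and the body of [Cloop]
    start with the tested register already decremented. *)
Inductive exec (O : nat -> Prop) : cmd -> regs -> regs -> Prop :=
| ex_skip R0 : exec O Cskip R0 R0
| ex_inc r R0 : exec O (Cinc r) R0 (upd R0 r (S (R0 r)))
| ex_orc1 r R0 : O (R0 r) -> exec O (Corc r) R0 (upd R0 r 1)
| ex_orc0 r R0 : ~ O (R0 r) -> exec O (Corc r) R0 (upd R0 r 0)
| ex_seq c d R0 R1 R2 : exec O c R0 R1 -> exec O d R1 R2 ->
    exec O (Cseq c d) R0 R2
| ex_ifS r c d R0 R1 k : R0 r = S k -> exec O c (upd R0 r k) R1 ->
    exec O (Cif r c d) R0 R1
| ex_if0 r c d R0 R1 : R0 r = 0 -> exec O d R0 R1 -> exec O (Cif r c d) R0 R1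
| ex_loop0 r c R0 : R0 r = 0 -> exec O (Cloop r c) R0 R0
| ex_loopS r c R0 R1 R2 k : R0 r = S k -> exec O c (upd R0 r k) R1 ->
    exec O (Cloop r c) R1 R2 -> exec O (Cloop r c) R0 R2.

Fixpoint clen (c : cmd) : nat :=
  match c with
  | Cskip => 0
  | Cinc _ | Corc _ => 1
  | Cseq c d => clen c + clen d
  | Cif _ c d => clen c + clen d + 2
  | Cloop _ c => clen c + 2
  end.

(* Register 1 is kept at 0, so that [DEC 1 j] is an unconditional jump. *)
Fixpoint compile (a : nat) (c : cmd) : prog :=
  match c with
  | Cskip => nil
  | Cinc r => INC r :: nil
  | Corc r => ORC r :: nil
  | Cseq c d => compile a c ++ compile (a + clen c) d
  | Cif r c d =>
      DEC r (a + clen c + 2) :: compile (S a) c ++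
      DEC 1 (a + clen c + clen d + 2) :: compile (a + clen c + 2) d
  | Cloop r c =>
      DEC r (a + clen c + 2) :: compile (S a) c ++ DEC 1 a :: nil
  end.

Fixpoint avoids1 (c : cmd) : Prop :=
  match c with
  | Cskip => True
  | Cinc r | Corc r => r <> 1
  | Cseq c d => avoids1 c /\ avoids1 d
  | Cif r c d => r <> 1 /\ avoids1 c /\ avoids1 d
  | Cloop r c => r <> 1 /\ avoids1 c
  end.

Lemma compile_length (c : cmd) : forall a, length (compile a c) = clen c.
Proof.
  induction c; intros; simpl; rewrite ?length_app; simpl;
    rewrite ?IHc, ?IHc1, ?IHc2; lia.
Qed.

Lemma upd_same R0 r v : upd R0 r v r = v.
Proof. unfold upd. now rewrite Nat.eqb_refl. Qed.

Lemma upd_other R0 r v i : i <> r -> upd R0 r v i = R0 i.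
Proof. intros H. unfold upd. now rewrite (proj2 (Nat.eqb_neq _ _) H). Qed.

Lemma exec_reg1 O c R0 R1 :
  exec O c R0 R1 -> avoids1 c -> R1 1 = R0 1.
Proof.
  induction 1; simpl; intros W.
  - reflexivity.
  - now rewrite upd_other by lia.
  - now rewrite upd_other by lia.
  - now rewrite upd_other by lia.
  - destruct W. rewrite IHexec2, IHexec1; auto.
  - rewrite IHexec by tauto. apply upd_other. intuition.
  - apply IHexec; tauto.
  - reflexivity.
  - rewrite IHexec2, IHexec1 by (simpl; tauto). apply upd_other. intuition.
Qed.

Lemma exec_upd_reg1 O c R0 R1 r k :
  exec O c (upd R0 r k) R1 -> avoids1 c -> r <> 1 -> R0 1 = 0 -> R1 1 = 0.
Proof.
  intros H W N Z. rewrite (exec_reg1 _ _ _ _ H W), upd_other; auto.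
Qed.

Lemma steps_trans O P c1 c2 c3 :
  steps O P c1 c2 -> steps O P c2 c3 -> steps O P c1 c3.
Proof. induction 1; auto. intros. econstructor; eauto. Qed.

Lemma nth_error_middle (pre post : prog) i a :
  length pre = a -> nth_error (pre ++ i :: post) a = Some i.
Proof.
  intros <-. rewrite nth_error_app2, Nat.sub_diag by lia. reflexivity.
Qed.

Lemma steps_jump O P a j R0 :
  nth_error P a = Some (DEC 1 j) -> R0 1 = 0 -> steps O P (a, R0) (j, R0).
Proof. intros. eapply steps_step; [eapply st_dec0; eauto | constructor]. Qed.

(** Jump targets are absolute, so the code is considered at an address [a] inside an arbitrary
    program; the induction moves parts of the program into [pre] and [post]. *)
Lemma compile_correct O c R0 R1 :
  exec O c R0 R1 -> avoids1 c -> R0 1 = 0 ->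
  forall pre post a, length pre = a ->
  steps O (pre ++ compile a c ++ post) (a, R0) (a + clen c, R1).
Proof.
  induction 1; simpl; intros W Z pre post a E.
  - rewrite Nat.add_0_r. constructor.
  - eapply steps_step; [apply st_inc; apply nth_error_middle; auto|].
    replace (a + 1) with (S a) by lia. constructor.
  - eapply steps_step; [eapply st_orc1; [apply nth_error_middle; auto | auto]|].
    replace (a + 1) with (S a) by lia. constructor.
  - eapply steps_step; [eapply st_orc0; [apply nth_error_middle; auto | auto]|].
    replace (a + 1) with (S a) by lia. constructor.
  - destruct W as [Wc Wd].
    eapply steps_trans.
    + rewrite <- app_assoc. apply IHexec1; auto.
    + rewrite <- app_assoc, app_assoc, Nat.add_assoc.
      apply IHexec2; auto.
      * erewrite exec_reg1; eauto.
      * rewrite length_app, compile_length; lia.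
  - destruct W as [Wr [Wc Wd]].
    eapply steps_step; [eapply st_decS; [apply nth_error_middle; auto | eauto]|].
    eapply steps_trans.
    + rewrite <- !app_assoc.
      change (pre ++ ?i :: ?l) with (pre ++ (i :: nil) ++ l).
      rewrite app_assoc. apply IHexec; auto.
      * rewrite upd_other; auto.
      * rewrite length_app; simpl; lia.
    + replace (a + (clen c + clen d + 2)) with (a + clen c + clen d + 2) by lia.
      apply steps_jump.
      * rewrite <- !app_assoc; cbn [app].
        change (pre ++ ?i :: ?l) with (pre ++ (i :: nil) ++ l).
        rewrite app_assoc, app_assoc. apply nth_error_middle.
        rewrite !length_app, compile_length; simpl; lia.
      * eapply exec_upd_reg1; eauto.
  - destruct W as [Wr [Wc Wd]].
    eapply steps_step; [eapply st_dec0; [apply nth_error_middle; auto | eauto]|].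
    replace (a + (clen c + clen d + 2)) with (a + clen c + 2 + clen d) by lia.
    rewrite <- !app_assoc; cbn [app].
    change (pre ++ ?i :: ?l) with (pre ++ (i :: nil) ++ l).
    rewrite app_assoc, app_assoc.
    change (?p ++ DEC 1 ?j :: ?l) with (p ++ (DEC 1 j :: nil) ++ l).
    rewrite app_assoc. apply IHexec; auto.
    rewrite !length_app, compile_length; simpl; lia.
  - replace (a + (clen c + 2)) with (a + clen c + 2) by lia.
    eapply steps_step; [eapply st_dec0; [apply nth_error_middle; auto | auto]|].
    constructor.
  - destruct W as [Wr Wc].
    eapply steps_step; [eapply st_decS; [apply nth_error_middle; auto | eauto]|].
    eapply steps_trans.
    + rewrite <- !app_assoc.
      change (pre ++ ?i :: ?l) with (pre ++ (i :: nil) ++ l).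
      rewrite app_assoc. apply IHexec1; auto.
      * rewrite upd_other; auto.
      * rewrite length_app; simpl; lia.
    + match goal with Hc : exec _ c _ ?Ra |- _ =>
        assert (Z1 : Ra 1 = 0) by (eapply exec_upd_reg1; eauto) end.
      eapply steps_trans.
      * apply steps_jump with (j := a); auto.
        rewrite <- !app_assoc; cbn [app].
        change (pre ++ ?i :: ?l) with (pre ++ (i :: nil) ++ l).
        rewrite app_assoc, app_assoc. apply nth_error_middle.
        rewrite !length_app, compile_length; simpl; lia.
      * apply (IHexec2 (conj Wr Wc) Z1 pre post a E).
Qed.

(** [compile_correct] speaks only of terminating runs. For divergence one turn of a loop is
    isolated, with at least one genuine step. *)
Lemma compile_loop_turn O r c R0 R1 k :
  R0 r = S k -> exec O c (upd R0 r k) R1 -> r <> 1 -> avoids1 c -> R0 1 = 0 ->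
  forall pre post a, length pre = a ->
  exists z, step O (pre ++ compile a (Cloop r c) ++ post) (a, R0) z /\
    steps O (pre ++ compile a (Cloop r c) ++ post) z (a, R1).
Proof.
  intros Hr Hc Wr Wc Z pre post a E. simpl.
  eexists; split; [eapply st_decS; [apply nth_error_middle; auto | eauto]|].
  eapply steps_trans.
  - rewrite <- !app_assoc.
    change (pre ++ ?i :: ?l) with (pre ++ (i :: nil) ++ l).
    rewrite app_assoc. eapply compile_correct; eauto.
    + rewrite upd_other; auto.
    + rewrite length_app; simpl; lia.
  - apply steps_jump.
    + rewrite <- !app_assoc; cbn [app].
      change (pre ++ ?i :: ?l) with (pre ++ (i :: nil) ++ l).
      rewrite app_assoc, app_assoc. apply nth_error_middle.
      rewrite !length_app, compile_length; simpl; lia.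
    + eapply exec_upd_reg1; eauto.
Qed.

(** * Determinism and non-termination of runs *)

Lemma step_det O P c c1 c2 : step O P c c1 -> step O P c c2 -> c1 = c2.
Proof.
  intros H1 H2; destruct H1; inversion H2; subst; try congruence; try tauto.
  all: match goal with
    | H : nth_error ?P ?a = Some _, H' : nth_error ?P ?a = Some _ |- _ =>
        rewrite H in H'; injection H'; intros; subst end; try congruence; try tauto.
Qed.

Lemma step_not_halted O P c c1 : step O P c c1 -> nth_error P (fst c) <> None.
Proof. destruct 1; simpl; congruence. Qed.

Lemma steps_to_halt O P c c1 ch :
  steps O P c c1 -> steps O P c ch -> nth_error P (fst ch) = None ->
  steps O P c1 ch.
Proof.
  induction 1 as [|c c2 c3 H1 H2 IH]; auto. intros Hh N. apply IH; auto.
  inversion Hh as [|x c4 x' H4 H5]; subst.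
  - exfalso. eapply step_not_halted; eauto.
  - now rewrite (step_det _ _ _ _ _ H1 H4).
Qed.

Inductive stepsn (O : nat -> Prop) (P : prog) : nat -> nat * regs -> nat * regs -> Prop :=
| stepsn_refl c : stepsn O P 0 c c
| stepsn_step k c1 c2 c3 : step O P c1 c2 -> stepsn O P k c2 c3 ->
    stepsn O P (S k) c1 c3.

Lemma steps_stepsn O P c d : steps O P c d <-> exists k, stepsn O P k c d.
Proof.
  split.
  - induction 1 as [|c1 c2 c3 H1 H2 [k IH]]; [exists 0|exists (S k)];
      econstructor; eauto.
  - intros [k H]. induction H; econstructor; eauto.
Qed.

(** By determinism a halting run from a state in [T] passes through the next state in [T] with
    strictly fewer steps left, which is an infinite descent. *)
Lemma recurrent_no_halt O P (T : nat * regs -> Prop) :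
  (forall c, T c -> exists c1 c2, step O P c c1 /\ steps O P c1 c2 /\ T c2) ->
  forall c ch, T c -> steps O P c ch -> nth_error P (fst ch) <> None.
Proof.
  intros HT c ch Tc Hs N. apply steps_stepsn in Hs as [k Hk].
  revert c Tc Hk. induction k as [k IH] using lt_wf_ind; intros c Tc Hk.
  destruct (HT c Tc) as (c1 & c2 & H1 & H2 & T2).
  inversion Hk as [x Ex | k' x c1' x' H3 H4]; subst.
  - eapply step_not_halted; eauto.
  - rename k' into k. rewrite <- (step_det _ _ _ _ _ H1 H3) in H4.
    apply steps_stepsn in H2 as [k2 H2].
    assert (exists k3, k3 <= k /\ stepsn O P k3 c2 ch) as (k3 & L3 & H5).
    { clear - H2 H4 N. revert k H4. induction H2 as [c|k2 a b c Ha Hb IH]; intros k Hk.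
      - exists k; auto.
      - inversion Hk as [x Ex | k' x b' x' Ha' Hk']; subst.
        + exfalso; eapply step_not_halted; eauto.
        + rewrite <- (step_det _ _ _ _ _ Ha Ha') in Hk'.
          destruct (IH k' Hk') as (k3 & ? & ?). exists k3; split; auto. }
    apply (IH k3 ltac:(lia) c2 T2 H5).
Qed.

(** * Primitive recursive functions *)

(** Cantor's pairing is easy to compute with counters by walking along diagonals, and it grows only
    quadratically, which keeps coded parameters short; [npair] is exponential in its first
    argument. *)
Definition cpair (x y : nat) : nat := Cantor.to_nat (x, y).
Definition pi1 (z : nat) : nat := fst (Cantor.of_nat z).
Definition pi2 (z : nat) : nat := snd (Cantor.of_nat z).

Lemma pi1_cpair x y : pi1 (cpair x y) = x.
Proof. unfold pi1, cpair. now rewrite Cantor.cancel_of_to. Qed.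

Lemma pi2_cpair x y : pi2 (cpair x y) = y.
Proof. unfold pi2, cpair. now rewrite Cantor.cancel_of_to. Qed.

(* Unary functions suffice: several arguments are passed as a Cantor pair. *)
Inductive pr (O : nat -> Prop) : (nat -> nat) -> Prop :=
| pr_id : pr O (fun x => x)
| pr_zero : pr O (fun _ => 0)
| pr_S0 : pr O S
| pr_fst0 : pr O pi1
| pr_snd0 : pr O pi2
| pr_comp f g : pr O f -> pr O g -> pr O (fun x => f (g x))
| pr_cpair f g : pr O f -> pr O g -> pr O (fun x => cpair (f x) (g x))
| pr_rec0 f g : pr O f -> pr O g ->
    pr O (fun z => nat_rect (fun _ => nat) (f (pi1 z))
      (fun k acc => g (cpair (pi1 z) (cpair k acc))) (pi2 z))
| pr_oracle o : (forall x, O x /\ o x = 1 \/ ~ O x /\ o x = 0) -> pr O o.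

Notation "c ;; d" := (Cseq c d) (at level 60, right associativity).

Ltac ueq :=
  apply functional_extensionality; intro; unfold upd;
  repeat match goal with |- context [Nat.eqb ?a ?b] =>
    destruct (Nat.eqb_spec a b); subst; try lia end;
  try reflexivity; try congruence; try lia.

Ltac uev :=
  unfold upd;
  repeat match goal with |- context [Nat.eqb ?a ?b] =>
    destruct (Nat.eqb_spec a b); subst; try lia end;
  auto; try lia.

Section Compile.
Variable O : nat -> Prop.

(** The loop invariant [F] is indexed by the number of turns still to come, which is the content of
    the loop register. *)
Lemma exec_loop r c (F : nat -> regs) k :
  (forall j, F j r = j) ->
  (forall j, j < k -> exec O c (upd (F (S j)) r j) (F j)) ->
  exec O (Cloop r c) (F k) (F 0).
Proof.
  intros Hr. induction k as [|k IH]; intros Hc.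
  - apply ex_loop0, Hr.
  - eapply ex_loopS; [apply Hr | apply Hc; lia | apply IH; intros; apply Hc; lia].
Qed.

Lemma exec_eq c R1 R2 R3 : exec O c R1 R2 -> R2 = R3 -> exec O c R1 R3.
Proof. now intros ? <-. Qed.

Lemma exec_eql c R1 R2 R3 : exec O c R1 R2 -> R1 = R3 -> exec O c R3 R2.
Proof. now intros ? <-. Qed.

Lemma exec_inc r R1 R2 : R2 = upd R1 r (S (R1 r)) -> exec O (Cinc r) R1 R2.
Proof. intros ->. constructor. Qed.

Definition Cclear a := Cloop a Cskip.

Lemma exec_clear a R1 : exec O (Cclear a) R1 (upd R1 a 0).
Proof.
  eapply exec_eql; [apply (exec_loop a Cskip (fun k => upd R1 a k) (R1 a))|ueq].
  - intros; apply upd_same.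
  - intros. eapply exec_eq; [constructor | ueq].
Qed.

Definition Cmove a b := Cloop a (Cinc b).

Lemma exec_move a b R1 : a <> b ->
  exec O (Cmove a b) R1 (upd (upd R1 b (R1 b + R1 a)) a 0).
Proof.
  intros N.
  eapply exec_eql; [eapply exec_eq;
    [apply (exec_loop a (Cinc b)
      (fun k => upd (upd R1 b (R1 b + (R1 a - k))) a k) (R1 a))|]|].
  - intros; apply upd_same.
  - intros. apply exec_inc. ueq.
  - ueq.
  - ueq.
Qed.

Definition Ccopy a b t := Cseq (Cloop a (Cseq (Cinc b) (Cinc t))) (Cmove t a).

Lemma exec_copy a b t R1 : a <> b -> a <> t -> b <> t -> R1 t = 0 ->
  exec O (Ccopy a b t) R1 (upd R1 b (R1 b + R1 a)).
Proof.
  intros N1 N2 N3 Z. eapply ex_seq.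
  - eapply exec_eql;
    [apply (exec_loop a _
      (fun k => upd (upd (upd R1 b (R1 b + (R1 a - k))) t (R1 a - k)) a k) (R1 a))|].
    + intros; apply upd_same.
    + intros. eapply ex_seq; apply exec_inc; [reflexivity|ueq].
    + ueq.
  - eapply exec_eq; [apply exec_move; auto|]. ueq.
Qed.

(* On entry [b] holds [z]; on exit [b+1] and [b+2] hold its components. *)
Definition Cunpair b :=
  Cloop b (Cif (b + 1) (Cinc (b + 2)) (Cseq (Cinc (b + 1)) (Cmove (b + 2) (b + 1)))).

Lemma exec_unpair b R1 : R1 (b + 1) = 0 -> R1 (b + 2) = 0 ->
  exec O (Cunpair b) R1
    (upd (upd (upd R1 b 0) (b + 1) (pi1 (R1 b))) (b + 2) (pi2 (R1 b))).
Proof.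
  intros Z1 Z2. eapply exec_eql; [eapply exec_eq; [apply (exec_loop b _
    (fun k => upd (upd (upd R1 b k) (b + 1) (pi1 (R1 b - k))) (b + 2) (pi2 (R1 b - k)))
    (R1 b))|]|].
  - intros. rewrite !upd_other by lia. apply upd_same.
  - intros j Hj. replace (R1 b - j) with (S (R1 b - S j)) by lia.
    set (z := R1 b - S j). unfold pi1, pi2.
    (* The successor in Cantor's enumeration moves along the diagonal, or opens the next one when
       the first component is exhausted. *)
    assert (E : of_nat (S z) = match fst (of_nat z) with
       | S x => (x, S (snd (of_nat z))) | 0 => (S (snd (of_nat z)), 0) end).
    { cbn [of_nat nat_rec nat_rect]. unfold of_nat.
      simpl. destruct (nat_rec _ _ _ z) as [[|x] y]; reflexivity. }
    rewrite E. clear E. destruct (of_nat z) as [[|x] y]; cbn [fst snd].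
    + apply ex_if0.
      * rewrite upd_other, upd_other, upd_same by lia; auto.
      * eapply ex_seq; [apply exec_inc; reflexivity|].
        eapply exec_eq; [apply exec_move; lia|]. ueq.
    + eapply ex_ifS.
      * rewrite upd_other, upd_other, upd_same by lia; reflexivity.
      * apply exec_inc. ueq.
  - rewrite Nat.sub_0_r. reflexivity.
  - rewrite Nat.sub_diag. unfold pi1, pi2; cbn. ueq.
Qed.

(* [b] and [b+1] hold [x] and [y]; [x+y] is accumulated in [b], and the triangular
   number of [x+y] is added to [y] in [b+2]. *)
Definition Cpairing b :=
  Cseq (Cloop (b + 1) (Cseq (Cinc (b + 2)) (Cinc b)))
  (Cseq (Cloop b (Cseq (Cinc (b + 2)) (Ccopy b (b + 2) (b + 1))))
  (Cmove (b + 2) b)).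

Definition tri (n : nat) := nat_rec (fun _ => nat) 0 (fun i m => S i + m) n.

Lemma exec_pairing b R1 : R1 (b + 2) = 0 ->
  exec O (Cpairing b) R1 (upd (upd R1 b (cpair (R1 b) (R1 (b + 1)))) (b + 1) 0).
Proof.
  intros Z. set (x := R1 b). set (y := R1 (b + 1)).
  eapply ex_seq; [|eapply ex_seq].
  - eapply exec_eql; [apply (exec_loop (b + 1) _
      (fun k => upd (upd (upd R1 (b + 1) k) (b + 2) (y - k)) b (x + (y - k))) y)|].
    + intros. rewrite !upd_other by lia. apply upd_same.
    + intros. eapply ex_seq; apply exec_inc; [reflexivity|]. ueq.
    + unfold x, y. ueq.
  - eapply exec_eql; [apply (exec_loop b _
      (fun k => upd (upd (upd R1 (b + 1) 0) (b + 2) (y + (tri (x + y) - tri k))) b k)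
      (x + y))|].
    + intros; apply upd_same.
    + intros j Hj. eapply ex_seq; [apply exec_inc; reflexivity|].
      eapply exec_eq; [apply exec_copy; try lia; solve [uev]|].
      * assert (tri (S j) <= tri (x + y)).
        { clear - Hj. revert Hj. generalize (x + y). induction n; intros; [lia|].
          destruct (Nat.eq_dec j n); [subst; lia|]. cbn [tri nat_rec nat_rect].
          unfold tri in IHn |- *. simpl. simpl in IHn. lia. }
        assert (tri (S j) = S j + tri j) by reflexivity.
        ueq.
    + ueq.
  - eapply exec_eq; [apply exec_move; lia|].
    unfold cpair, to_nat. fold (tri (y + x)). rewrite (Nat.add_comm y x).
    change (tri 0) with 0. ueq.
Qed.

(** Eight work registers from [b] on suffice for the machines below; listing them makes equality of
    states a finite case analysis. *)
Definition frame (r : regs) (b v0 v1 v2 v3 v4 v5 v6 v7 : nat) : regs :=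
  fun i => if i <? b then r i else
    match i - b with
    | 0 => v0 | 1 => v1 | 2 => v2 | 3 => v3
    | 4 => v4 | 5 => v5 | 6 => v6 | 7 => v7 | _ => 0 end.

Lemma frame_at r b v0 v1 v2 v3 v4 v5 v6 v7 k :
  frame r b v0 v1 v2 v3 v4 v5 v6 v7 (b + k) =
  match k with
    | 0 => v0 | 1 => v1 | 2 => v2 | 3 => v3
    | 4 => v4 | 5 => v5 | 6 => v6 | 7 => v7 | _ => 0 end.
Proof.
  unfold frame. destruct (Nat.ltb_spec (b + k) b); [lia|].
  replace (b + k - b) with k by lia. reflexivity.
Qed.

Lemma frame_base r b v0 v1 v2 v3 v4 v5 v6 v7 :
  frame r b v0 v1 v2 v3 v4 v5 v6 v7 b = v0.
Proof. rewrite <- (Nat.add_0_r b) at 2. now rewrite frame_at. Qed.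

(** The function is computed in place at any base [b], with clean registers above before and after,
    so that machines can be nested at higher bases. The condition [2 <= b] spares the input register
    0 and the jump register 1. *)
Definition implements (f : nat -> nat) (c : nat -> cmd) : Prop :=
  forall b, 2 <= b -> avoids1 (c b) /\
  forall r, (forall i, b < i -> r i = 0) -> exec O (c b) r (upd r b (f (r b))).

End Compile.

Ltac frame_eq :=
  let i := fresh "i" in
  apply functional_extensionality; intro i; unfold upd, frame;
  match goal with |- context [i <? ?b] =>
    destruct (Nat.ltb_spec i b) as [Hlt|Hge];
    [ repeat match goal with |- context [Nat.eqb i ?c] =>
        destruct (Nat.eqb_spec i c); [lia|] end; reflexivity
    | let k := fresh "k" in
      remember (i - b) as k; assert (i = b + k) by lia; subst i;
      rewrite ?Nat.add_0_r, ?Nat.ltb_irrefl, ?Nat.sub_diag;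
      repeat match goal with |- context [b + ?a <? b] =>
        rewrite (proj2 (Nat.ltb_ge (b + a) b)) by lia end;
      repeat match goal with |- context [b + ?a - b] =>
        replace (b + a - b) with a by lia end;
      cbn [Nat.eqb];
      do 8 (destruct k as [|k]; [
        repeat match goal with |- context [Nat.eqb ?c ?d] =>
          destruct (Nat.eqb_spec c d); try lia end;
        try reflexivity; try congruence; try lia|]);
      repeat match goal with |- context [Nat.eqb ?c ?d] =>
          destruct (Nat.eqb_spec c d); try lia end;
        try reflexivity; try congruence; try lia ]
  end.

Ltac frame_val := rewrite <- ?Nat.add_assoc, ?frame_at, ?frame_base; reflexivity.

Ltac run op fr :=
  eapply ex_seq; [eapply exec_eq; [apply op; try lia; try frame_val | 
    instantiate (1 := fr); rewrite <- ?Nat.add_assoc, ?frame_at, ?frame_base;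
    cbn [Nat.add]; try frame_eq] |].
Ltac run_last op fr :=
  eapply exec_eq; [apply op; try lia; try frame_val | 
    transitivity fr; [rewrite ?frame_at, ?frame_base; try frame_eq|]].

Ltac frame_zero b :=
  let i := fresh in let H := fresh in
  intros i H; replace i with (b + (i - b)) by lia; rewrite frame_at;
  do 8 (try (destruct (i - b) as [|?] eqn:?; [try lia; reflexivity|]));
  do 8 match goal with |- match ?k with _ => _ end = _ =>
    destruct k; try lia; try reflexivity end; reflexivity.

Lemma frame_intro r b : (forall i, b < i -> r i = 0) ->
  r = frame r b (r b) 0 0 0 0 0 0 0.
Proof.
  intros Hr. apply functional_extensionality; intro i; unfold frame.
  destruct (Nat.ltb_spec i b); auto.
  destruct (Nat.eq_dec i b); [subst; rewrite Nat.sub_diag; auto|].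
  rewrite Hr by lia. destruct (i - b) as [|k] eqn:?; [lia|].
  now do 7 (destruct k as [|k]; auto).
Qed.

(** During the loop, [b] holds the index of the iteration, [b + 1] the parameter, [b + 2] the turns
    left and [b + 3] the accumulator; the argument of [g] is assembled from [b + 4] on. *)
Lemma implements_rec O f g cf cg : implements O f cf -> implements O g cg ->
  implements O (fun z => nat_rect (fun _ => nat) (f (pi1 z))
      (fun k acc => g (cpair (pi1 z) (cpair k acc))) (pi2 z))
  (fun b => Cunpair b ;; Ccopy (b + 1) (b + 3) (b + 4) ;; cf (b + 3) ;;
    Cloop (b + 2)
      (Ccopy (b + 1) (b + 4) (b + 7) ;; Ccopy b (b + 5) (b + 7) ;;
       Cmove (b + 3) (b + 6) ;; Cpairing (b + 5) ;; Cpairing (b + 4) ;;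
       cg (b + 4) ;; Cmove (b + 4) (b + 3) ;; Cinc b) ;;
    Cclear b ;; Cclear (b + 1) ;; Cmove (b + 3) b).
Proof.
  intros Hf Hg b Hb.
  destruct (Hf (b + 3) ltac:(lia)) as [Wf Ef].
  destruct (Hg (b + 4) ltac:(lia)) as [Wg Eg].
  split; [simpl; repeat split; auto; lia|].
  intros r Hr. set (z := r b). set (x := pi1 z). set (n := pi2 z).
  set (h := fun m => nat_rect (fun _ => nat) (f x) (fun k acc => g (cpair x (cpair k acc))) m).
  assert (E := frame_intro r b Hr). fold z in E.
  rewrite E at 1.
  run exec_unpair (frame r b 0 x n 0 0 0 0 0).
  run exec_copy (frame r b 0 x n x 0 0 0 0).
  run Ef (frame r b 0 x n (f x) 0 0 0 0).
  { frame_zero b. }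
  eapply ex_seq.
  { eapply exec_eql; [apply (exec_loop O (b + 2) _
      (fun k => frame r b (n - k) x k (h (n - k)) 0 0 0 0) n)|].
    - intros; apply frame_at.
    - intros j Hj.
      eapply exec_eql; [|instantiate
        (1 := frame r b (n - S j) x j (h (n - S j)) 0 0 0 0); symmetry; frame_eq].
      replace (n - j) with (S (n - S j)) by lia.
      set (k := n - S j).
      run exec_copy (frame r b k x j (h k) x 0 0 0).
      run exec_copy (frame r b k x j (h k) x k 0 0).
      run exec_move (frame r b k x j 0 x k (h k) 0).
      run exec_pairing (frame r b k x j 0 x (cpair k (h k)) 0 0).
      run exec_pairing (frame r b k x j 0 (cpair x (cpair k (h k))) 0 0 0).
      run Eg (frame r b k x j 0 (h (S k)) 0 0 0).
      { frame_zero b. }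
      run exec_move (frame r b k x j (h (S k)) 0 0 0 0).
      apply exec_inc. rewrite frame_base. frame_eq.
    - rewrite Nat.sub_diag. reflexivity. }
  rewrite Nat.sub_0_r.
  run exec_clear (frame r b 0 x 0 (h n) 0 0 0 0).
  run exec_clear (frame r b 0 0 0 (h n) 0 0 0 0).
  run_last exec_move (frame r b (h n) 0 0 0 0 0 0 0).
  rewrite E. frame_eq.
Qed.

Lemma implements_pair O f g cf cg : implements O f cf -> implements O g cg ->
  implements O (fun x => cpair (f x) (g x))
  (fun b => Ccopy b (b + 1) (b + 3) ;; cf (b + 1) ;; Ccopy b (b + 2) (b + 3) ;;
    cg (b + 2) ;; Cclear b ;; Cpairing (b + 1) ;; Cmove (b + 1) b).
Proof.
  intros Hf Hg b Hb.
  destruct (Hf (b + 1) ltac:(lia)) as [Wf Ef].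
  destruct (Hg (b + 2) ltac:(lia)) as [Wg Eg].
  split; [simpl; repeat split; auto; lia|].
  intros r Hr. set (x := r b).
  assert (E := frame_intro r b Hr). fold x in E.
  rewrite E at 1.
  run exec_copy (frame r b x x 0 0 0 0 0 0).
  run Ef (frame r b x (f x) 0 0 0 0 0 0).
  { frame_zero b. }
  run exec_copy (frame r b x (f x) x 0 0 0 0 0).
  run Eg (frame r b x (f x) (g x) 0 0 0 0 0).
  { frame_zero b. }
  run exec_clear (frame r b 0 (f x) (g x) 0 0 0 0 0).
  run exec_pairing (frame r b 0 (cpair (f x) (g x)) 0 0 0 0 0 0).
  run_last exec_move (frame r b (cpair (f x) (g x)) 0 0 0 0 0 0 0).
  rewrite E. frame_eq.
Qed.

Theorem pr_implementable O f : pr O f -> exists c, implements O f c.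
Proof.
  induction 1 as [| | | | |f g _ [cf Hf] _ [cg Hg] | f g _ [cf Hf] _ [cg Hg]
    | f g _ [cf Hf] _ [cg Hg] | o Ho].
  - exists (fun _ => Cskip). split; [exact I|]. intros.
    eapply exec_eq; [constructor|ueq].
  - exists Cclear. split; [simpl; lia|]. intros. apply exec_clear.
  - exists Cinc. split; [simpl; lia|]. intros. now apply exec_inc.
  - exists (fun b => Cunpair b ;; Cclear (b + 2) ;; Cmove (b + 1) b).
    split; [simpl; repeat split; lia|]. intros r Hr. set (x := r b).
    assert (E := frame_intro r b Hr). fold x in E. rewrite E at 1.
    run exec_unpair (frame r b 0 (pi1 x) (pi2 x) 0 0 0 0 0).
    run exec_clear (frame r b 0 (pi1 x) 0 0 0 0 0 0).
    run_last exec_move (frame r b (pi1 x) 0 0 0 0 0 0 0).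
    rewrite E. frame_eq.
  - exists (fun b => Cunpair b ;; Cclear (b + 1) ;; Cmove (b + 2) b).
    split; [simpl; repeat split; lia|]. intros r Hr. set (x := r b).
    assert (E := frame_intro r b Hr). fold x in E. rewrite E at 1.
    run exec_unpair (frame r b 0 (pi1 x) (pi2 x) 0 0 0 0 0).
    run exec_clear (frame r b 0 0 (pi2 x) 0 0 0 0 0).
    run_last exec_move (frame r b (pi2 x) 0 0 0 0 0 0 0).
    rewrite E. frame_eq.
  - exists (fun b => cg b ;; cf b). intros b Hb.
    destruct (Hf b Hb) as [Wf Ef]. destruct (Hg b Hb) as [Wg Eg].
    split; [simpl; auto|]. intros r Hr. eapply ex_seq; [apply Eg, Hr|].
    eapply exec_eq; [apply Ef|].
    + intros. rewrite upd_other by lia. auto.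
    + rewrite upd_same. ueq.
  - eexists; eapply implements_pair; eauto.
  - eexists; eapply implements_rec; eauto.
  - exists Corc. split; [simpl; lia|]. intros r Hr.
    destruct (Ho (r b)) as [[Hx ->]|[Hx ->]]; now constructor.
Qed.

Lemma init_frame x :
  init_regs x = frame (fun _ => 0) 0 x 0 0 0 0 0 0 0.
Proof.
  apply functional_extensionality; intro i; unfold init_regs, frame. simpl.
  rewrite Nat.sub_0_r. now do 8 (destruct i as [|i]; auto).
Qed.

Ltac frame0_eq :=
  let i := fresh "i" in
  apply functional_extensionality; intro i; unfold upd, frame; simpl;
  rewrite ?Nat.sub_0_r; do 8 (destruct i as [|i]; [try reflexivity; try lia|]);
  try reflexivity; try lia.

Ltac run0 op fr :=
  eapply ex_seq; [eapply exec_eq; [apply op; try lia; try reflexivity |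
    instantiate (1 := fr); try frame0_eq] |].

(** The common form of all algorithms used here: search for the least [w] with [nq x w = 0], then
    output [v x w]. Divergence is stated for the code inside any program because the halting oracle
    will be asked about the search preceded by other instructions. *)
Theorem search_cmd O nq v :
  pr O (fun z => nq (pi1 z) (pi2 z)) -> pr O (fun z => v (pi1 z) (pi2 z)) ->
  exists c, avoids1 c /\
  (forall x w, nq x w = 0 -> (forall w', w' < w -> nq x w' <> 0) ->
     exists r, exec O c (init_regs x) r /\ r 0 = v x w) /\
  (forall x, (forall w, nq x w <> 0) ->
     forall pre post ch,
     steps O (pre ++ compile (length pre) c ++ post) (length pre, init_regs x) ch ->
     nth_error (pre ++ compile (length pre) c ++ post) (fst ch) <> None).
Proof.
  intros Hq Hv.
  destruct (pr_implementable _ _ Hq) as [cq Iq].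
  destruct (pr_implementable _ _ Hv) as [cv Iv].
  destruct (Iq 5 ltac:(lia)) as [Wq Eq]. destruct (Iv 2 ltac:(lia)) as [Wv Ev].
  (* Register 2 keeps the input, 3 the current candidate and 4 the value of [nq] there; [Cif]
     decrements 4, hence the [Cinc 4]. *)
  set (body := Cclear 4 ;; Ccopy 2 5 7 ;; Ccopy 3 6 7 ;; Cpairing 5 ;; cq 5 ;;
    Cmove 5 4 ;; Cif 4 (Cinc 4 ;; Cinc 3) Cskip).
  set (F := fun x t a => frame (fun _ => 0) 0 0 0 x t a 0 0 0).
  assert (Wb : avoids1 body) by (simpl; repeat split; auto).
  assert (Z5 : forall v0 v1 v2 v3 v4 v5 i, 5 < i ->
    frame (fun _ => 0) 0 v0 v1 v2 v3 v4 v5 0 0 i = 0).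
  { intros. unfold frame. simpl. rewrite Nat.sub_0_r.
    do 6 (destruct i as [|i]; [lia|]). now do 2 (destruct i as [|i]; auto). }
  assert (Z2 : forall v0 v1 v2 i, 2 < i ->
    frame (fun _ => 0) 0 v0 v1 v2 0 0 0 0 0 i = 0).
  { intros. unfold frame. simpl. rewrite Nat.sub_0_r.
    do 3 (destruct i as [|i]; [lia|]). now do 5 (destruct i as [|i]; auto). }
  assert (Eb : forall x t a, exec O body (upd (F x t (S a)) 4 a)
    (if nq x t =? 0 then F x t 0 else F x (S t) (nq x t))).
  { intros x t a. unfold F.
    eapply exec_eql; [|instantiate (1 := F x t a); unfold F; symmetry; frame0_eq].
    unfold F, body.
    run0 exec_clear (frame (fun _ => 0) 0 0 0 x t 0 0 0 0).
    run0 exec_copy (frame (fun _ => 0) 0 0 0 x t 0 x 0 0).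
    run0 exec_copy (frame (fun _ => 0) 0 0 0 x t 0 x t 0).
    run0 exec_pairing (frame (fun _ => 0) 0 0 0 x t 0 (cpair x t) 0 0).
    eapply ex_seq; [eapply exec_eq; [apply Eq, Z5|]|].
    { instantiate (1 := frame (fun _ => 0) 0 0 0 x t 0 (nq x t) 0 0).
      change (frame (fun _ => 0) 0 0 0 x t 0 (cpair x t) 0 0 5) with (cpair x t).
      rewrite pi1_cpair, pi2_cpair. frame0_eq. }
    run0 exec_move (frame (fun _ => 0) 0 0 0 x t (nq x t) 0 0 0).
    destruct (Nat.eqb_spec (nq x t) 0) as [E|E].
    - apply ex_if0; [exact E|]. rewrite E. constructor.
    - destruct (nq x t) as [|k] eqn:Ek; [lia|].
      eapply ex_ifS; [reflexivity|].
      eapply ex_seq; apply exec_inc; [reflexivity|]. frame0_eq. }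
  exists (Cmove 0 2 ;; Cinc 4 ;; Cloop 4 body ;; Ccopy 3 4 5 ;; Cclear 3 ;;
    Cmove 4 3 ;; Cpairing 2 ;; cv 2 ;; Cmove 2 0).
  split; [simpl; repeat split; auto|]. split.
  - intros x w Hw Hlt. rewrite init_frame.
    eexists; split.
    + run0 exec_move (frame (fun _ => 0) 0 0 0 x 0 0 0 0 0).
      run0 exec_inc (F x 0 1).
      eapply ex_seq.
      { instantiate (1 := F x w 0).
        assert (H : forall d t a, t + d = w -> exec O (Cloop 4 body) (F x t (S a)) (F x w 0)).
        { induction d as [|d IH]; intros t a Ht.
          - eapply ex_loopS; [reflexivity | apply Eb|].
            replace t with w by lia. rewrite Hw. simpl. now apply ex_loop0.
          - eapply ex_loopS; [reflexivity | apply Eb|].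
            assert (Hn := Hlt t ltac:(lia)).
            destruct (Nat.eqb_spec (nq x t) 0); [lia|].
            destruct (nq x t); [lia|]. apply IH; lia. }
        apply (H w); lia. }
      unfold F.
      run0 exec_copy (frame (fun _ => 0) 0 0 0 x w w 0 0 0).
      run0 exec_clear (frame (fun _ => 0) 0 0 0 x 0 w 0 0 0).
      run0 exec_move (frame (fun _ => 0) 0 0 0 x w 0 0 0 0).
      run0 exec_pairing (frame (fun _ => 0) 0 0 0 (cpair x w) 0 0 0 0 0).
      eapply ex_seq; [eapply exec_eq; [apply Ev, Z2|]|].
      { instantiate (1 := frame (fun _ => 0) 0 0 0 (v x w) 0 0 0 0 0).
        change (frame (fun _ => 0) 0 0 0 (cpair x w) 0 0 0 0 0 2) with (cpair x w).
        rewrite pi1_cpair, pi2_cpair. frame0_eq. }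
      apply exec_move. lia.
    + reflexivity.
  - intros x Hx pre post ch Hs. rewrite init_frame in Hs.
    set (P := pre ++ _) in *. cbn [compile clen] in P.
    set (a := length pre) in *.
    pose (a1 := a + clen (Cmove 0 2 ;; Cinc 4)).
    set (pre' := pre ++ compile a (Cmove 0 2 ;; Cinc 4)).
    assert (Lp : length pre' = a1) by (unfold pre'; now rewrite length_app, compile_length).
    set (post' := compile (a1 + clen (Cloop 4 body)) (Ccopy 3 4 5 ;; Cclear 3 ;;
    Cmove 4 3 ;; Cpairing 2 ;; cv 2 ;; Cmove 2 0) ++ post).
    assert (EP : P = pre' ++ compile a1 (Cloop 4 body) ++ post').
    { unfold P, pre', post'. rewrite <- !app_assoc. f_equal.
      unfold a1. cbn [compile clen]. rewrite <- !app_assoc, !Nat.add_assoc. reflexivity. }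
    assert (H0 : steps O P (a, frame (fun _ => 0) 0 x 0 0 0 0 0 0 0) (a1, F x 0 1)).
    { rewrite EP. unfold pre'. rewrite <- app_assoc. apply compile_correct; auto.
      - run0 exec_move (frame (fun _ => 0) 0 0 0 x 0 0 0 0 0).
        apply exec_inc. unfold F. frame0_eq.
      - simpl; repeat split; lia. }
    intros N.
    assert (Hs' := steps_to_halt _ _ _ _ _ H0 Hs N).
    refine (recurrent_no_halt O P
      (fun z => exists t k, z = (a1, F x t (S k))) _ _ ch _ Hs' N).
    2:{ exists 0, 0; reflexivity. }
    intros z (t & k & ->).
    destruct (compile_loop_turn O 4 body (F x t (S k)) _ k eq_refl (Eb x t k)
      ltac:(lia) Wb eq_refl pre' post' a1 Lp) as (z' & S1 & S2).
    rewrite <- EP in S1, S2. exists z', (a1, F x (S t) (nq x t)).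
    assert (Hn := Hx t). destruct (Nat.eqb_spec (nq x t) 0); [lia|].
    repeat split; auto. destruct (nq x t) as [|k']; [lia|]. now exists (S t), k'.
Qed.

(** * Closure properties of primitive recursive functions and predicates *)

Lemma pr_ext O f g : (forall x, g x = f x) -> pr O f -> pr O g.
Proof. intros H. now replace g with f by (apply functional_extensionality; auto). Qed.

Lemma pr_const O k : pr O (fun _ => k).
Proof.
  induction k; [apply pr_zero|].
  exact (pr_comp O S (fun _ => k) (pr_S0 O) IHk).
Qed.

Lemma pr_S O a : pr O a -> pr O (fun x => S (a x)).
Proof. apply (pr_comp O S), pr_S0. Qed.

Lemma pr_pi1 O a : pr O a -> pr O (fun x => pi1 (a x)).
Proof. apply (pr_comp O pi1), pr_fst0. Qed.

Lemma pr_pi2 O a : pr O a -> pr O (fun x => pi2 (a x)).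
Proof. apply (pr_comp O pi2), pr_snd0. Qed.

Lemma pr_comp2 O (F : nat -> nat -> nat) a b :
  pr O (fun z => F (pi1 z) (pi2 z)) -> pr O a -> pr O b ->
  pr O (fun x => F (a x) (b x)).
Proof.
  intros HF Ha Hb.
  eapply pr_ext; [|exact (pr_comp O _ _ HF (pr_cpair O a b Ha Hb))].
  intros. cbn beta. now rewrite pi1_cpair, pi2_cpair.
Qed.

Lemma pr_rec O n a (F : nat -> nat -> nat -> nat) :
  pr O n -> pr O a ->
  pr O (fun z => F (pi1 (pi1 z)) (pi2 (pi1 z)) (pi2 z)) ->
  pr O (fun x => nat_rect (fun _ => nat) (a x) (F x) (n x)).
Proof.
  intros Hn Ha HF.
  assert (HF' : pr O (fun z => F (pi1 z) (pi1 (pi2 z)) (pi2 (pi2 z)))).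
  { eapply pr_ext; [|refine (pr_comp O _
      (fun z => cpair (cpair (pi1 z) (pi1 (pi2 z))) (pi2 (pi2 z))) HF _)].
    - intros. cbn beta. now rewrite pi1_cpair, !pi2_cpair, pi1_cpair.
    - auto using pr_cpair, pr_pi1, pr_pi2, pr_id. }
  eapply pr_ext; [|refine (pr_comp O _ (fun x => cpair x (n x)) (pr_rec0 O _ _ Ha HF') _);
    auto using pr_cpair, pr_id].
  intros x. cbn beta. rewrite pi1_cpair, pi2_cpair.
  induction (n x) as [|k IH]; simpl; auto. now rewrite IH, pi1_cpair, !pi2_cpair, pi1_cpair.
Qed.

Ltac prim :=
  cbv beta;
  first
  [ assumption
  | apply pr_id | apply pr_const
  | apply pr_S; prim | apply pr_pi1; prim | apply pr_pi2; prim
  | apply pr_cpair; prim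
  | match goal with H : pr ?O ?b |- pr ?O (fun x => ?b (@?g x)) =>
      apply (pr_comp O b g H); prim end ].

Lemma pr_pred O a : pr O a -> pr O (fun x => pred (a x)).
Proof.
  intros H. apply pr_ext with
    (fun x => nat_rect (fun _ => nat) 0 ((fun _ k _ => k) x) (a x)).
  - intros; destruct (a x); reflexivity.
  - apply pr_rec; prim.
Qed.

Lemma pr_add O a b : pr O a -> pr O b -> pr O (fun x => a x + b x).
Proof.
  intros. apply pr_ext with
    (fun x => nat_rect (fun _ => nat) (b x) ((fun _ _ r => S r) x) (a x)).
  - intros; induction (a x); simpl; auto.
  - apply pr_rec; prim.
Qed.

Lemma pr_sub O a b : pr O a -> pr O b -> pr O (fun x => a x - b x).
Proof.
  intros. apply pr_ext with
    (fun x => nat_rect (fun _ => nat) (a x) ((fun _ _ r => pred r) x) (b x)).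
  - intros; induction (b x); simpl; lia.
  - apply pr_rec; try prim; apply pr_pred; prim.
Qed.

Lemma pr_mul O a b : pr O a -> pr O b -> pr O (fun x => a x * b x).
Proof.
  intros. apply pr_ext with
    (fun x => nat_rect (fun _ => nat) 0 ((fun x _ r => b x + r) x) (a x)).
  - intros; induction (a x); simpl; auto.
  - apply pr_rec; try prim. apply pr_add; prim.
Qed.

Lemma pr_pow O a b : pr O a -> pr O b -> pr O (fun x => a x ^ b x).
Proof.
  intros. apply pr_ext with
    (fun x => nat_rect (fun _ => nat) 1 ((fun x _ r => a x * r) x) (b x)).
  - intros; induction (b x); simpl; auto.
  - apply pr_rec; try prim. apply pr_mul; prim.
Qed.

Lemma pr_ifz O a b c : pr O a -> pr O b -> pr O c ->
  pr O (fun x => if a x =? 0 then b x else c x).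
Proof.
  intros. apply pr_ext with
    (fun x => nat_rect (fun _ => nat) (b x) ((fun x _ _ => c x) x) (a x)).
  - intros; destruct (a x); reflexivity.
  - apply pr_rec; prim.
Qed.

Notation prb O p := (pr O (fun x => Nat.b2n (p x))).

Lemma pr_if O p b c : prb O p -> pr O b -> pr O c ->
  pr O (fun x => if p x then b x else c x).
Proof.
  intros. apply pr_ext with (fun x => if Nat.b2n (p x) =? 0 then c x else b x).
  - intros; destruct (p x); reflexivity.
  - apply pr_ifz; prim.
Qed.

Lemma prb_leb O a b : pr O a -> pr O b -> prb O (fun x => a x <=? b x).
Proof.
  intros. apply pr_ext with (fun x => if a x - b x =? 0 then 1 else 0).
  - intros; destruct (Nat.leb_spec (a x) (b x)), (Nat.eqb_spec (a x - b x) 0);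
      simpl; lia.
  - apply pr_ifz; try prim. now apply pr_sub.
Qed.

Lemma prb_ltb O a b : pr O a -> pr O b -> prb O (fun x => a x <? b x).
Proof. intros. unfold Nat.ltb. apply (prb_leb O (fun x => S (a x))); prim. Qed.

Lemma prb_negb O p : prb O p -> prb O (fun x => negb (p x)).
Proof.
  intros. apply pr_ext with (fun x => if p x then 0 else 1).
  - intros; destruct (p x); reflexivity.
  - apply pr_if; prim.
Qed.

Lemma prb_andb O p q : prb O p -> prb O q -> prb O (fun x => p x && q x).
Proof.
  intros. apply pr_ext with (fun x => if p x then Nat.b2n (q x) else 0).
  - intros; destruct (p x); reflexivity.
  - apply pr_if; prim.
Qed.

Lemma prb_orb O p q : prb O p -> prb O q -> prb O (fun x => p x || q x).
Proof.
  intros. apply pr_ext with (fun x => if p x then 1 else Nat.b2n (q x)).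
  - intros; destruct (p x); reflexivity.
  - apply pr_if; prim.
Qed.

Lemma prb_if O p q r : prb O p -> prb O q -> prb O r ->
  prb O (fun x => if p x then q x else r x).
Proof.
  intros. apply pr_ext with (fun x => if p x then Nat.b2n (q x) else Nat.b2n (r x)).
  - intros; destruct (p x); reflexivity.
  - apply pr_if; prim.
Qed.

Lemma prb_eqb O a b : pr O a -> pr O b -> prb O (fun x => a x =? b x).
Proof.
  intros. apply pr_ext with (fun x => Nat.b2n ((a x <=? b x) && (b x <=? a x))).
  - intros; f_equal. destruct (Nat.eqb_spec (a x) (b x)), (Nat.leb_spec (a x) (b x)),
      (Nat.leb_spec (b x) (a x)); simpl; lia.
  - apply prb_andb; apply prb_leb; prim.
Qed.

(** * Bounded sums, counting and search *)

Fixpoint sumn (n : nat) (f : nat -> nat) : nat :=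
  match n with 0 => 0 | S k => sumn k f + f k end.

Definition cnt (n : nat) (p : nat -> bool) : nat := sumn n (fun i => Nat.b2n (p i)).

Definition exb (n : nat) (p : nat -> bool) : bool := 0 <? cnt n p.

Definition allb (n : nat) (p : nat -> bool) : bool := negb (exb n (fun i => negb (p i))).

Fixpoint least (n : nat) (p : nat -> bool) : nat :=
  match n with
  | 0 => 0
  | S k => if least k p <? k then least k p else if p k then k else S k
  end.

Lemma pr_sumn O n (F : nat -> nat -> nat) :
  pr O n -> pr O (fun z => F (pi1 z) (pi2 z)) ->
  pr O (fun x => sumn (n x) (F x)).
Proof.
  intros Hn HF. apply pr_ext with
    (fun x => nat_rect (fun _ => nat) 0 ((fun x k r => r + F x k) x) (n x)).
  - intros; induction (n x); simpl; auto.
  - apply pr_rec; try prim. apply pr_add; try prim. apply (pr_comp2 O F); prim.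
Qed.

Lemma pr_cnt O n (p : nat -> nat -> bool) :
  pr O n -> prb O (fun z => p (pi1 z) (pi2 z)) ->
  pr O (fun x => cnt (n x) (p x)).
Proof.
  intros. unfold cnt. apply (pr_sumn O n (fun x i => Nat.b2n (p x i))); prim.
Qed.

Lemma prb_exb O n (p : nat -> nat -> bool) :
  pr O n -> prb O (fun z => p (pi1 z) (pi2 z)) ->
  prb O (fun x => exb (n x) (p x)).
Proof.
  intros. apply (prb_ltb O (fun _ => 0) (fun x => cnt (n x) (p x))); [prim|].
  now apply pr_cnt.
Qed.

Lemma prb_allb O n (p : nat -> nat -> bool) :
  pr O n -> prb O (fun z => p (pi1 z) (pi2 z)) ->
  prb O (fun x => allb (n x) (p x)).
Proof.
  intros. apply (prb_negb O (fun x => exb (n x) (fun i => negb (p x i)))).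
  apply (prb_exb O n (fun x i => negb (p x i))); [prim|].
  now apply (prb_negb O (fun z => p (pi1 z) (pi2 z))).
Qed.

Lemma prb_comp2 O (p : nat -> nat -> bool) a b :
  prb O (fun z => p (pi1 z) (pi2 z)) -> pr O a -> pr O b ->
  prb O (fun x => p (a x) (b x)).
Proof. apply (pr_comp2 O (fun x y => Nat.b2n (p x y))). Qed.

Lemma pr_least O n (p : nat -> nat -> bool) :
  pr O n -> prb O (fun z => p (pi1 z) (pi2 z)) ->
  pr O (fun x => least (n x) (p x)).
Proof.
  intros Hn Hp. apply pr_ext with
    (fun x => nat_rect (fun _ => nat) 0
      ((fun x k r => if r <? k then r else if p x k then k else S k) x) (n x)).
  - intros; induction (n x) as [|k IH]; simpl; auto. now rewrite <- IH.
  - apply pr_rec; try prim. apply pr_if; [apply prb_ltb; prim | prim |].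
    apply pr_if; try prim. apply (prb_comp2 O p); prim.
Qed.

Lemma pr_iter O n a (F : nat -> nat -> nat) :
  pr O n -> pr O a -> pr O (fun z => F (pi1 z) (pi2 z)) ->
  pr O (fun x => Nat.iter (n x) (F x) (a x)).
Proof.
  intros. apply pr_ext with
    (fun x => nat_rect (fun _ => nat) (a x) ((fun x _ r => F x r) x) (n x)).
  - reflexivity.
  - apply pr_rec; try prim. apply (pr_comp2 O F); prim.
Qed.

Lemma sumn_ext n f g : (forall i, i < n -> f i = g i) -> sumn n f = sumn n g.
Proof. induction n; simpl; intros H; auto. rewrite IHn, H; auto. Qed.

Lemma sumn_le n f g : (forall i, i < n -> f i <= g i) -> sumn n f <= sumn n g.
Proof.
  induction n; simpl; intros H; auto.
  assert (f n <= g n) by auto. assert (sumn n f <= sumn n g) by auto. lia.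
Qed.

Lemma sumn_add n f g : sumn n (fun i => f i + g i) = sumn n f + sumn n g.
Proof. induction n; simpl; lia. Qed.

Lemma sumn_mul n k f : sumn n (fun i => k * f i) = k * sumn n f.
Proof. induction n; simpl; lia. Qed.

Lemma sumn_const n k : sumn n (fun _ => k) = n * k.
Proof. induction n; simpl; lia. Qed.

Lemma sumn_le_const n f k : (forall i, i < n -> f i <= k) -> sumn n f <= n * k.
Proof. intros H. rewrite <- sumn_const. now apply sumn_le. Qed.

Lemma sumn_zero n f : (forall i, i < n -> f i = 0) -> sumn n f = 0.
Proof.
  intros H. rewrite (sumn_ext n f (fun _ => 0)) by auto. now rewrite sumn_const, Nat.mul_0_r.
Qed.

Lemma sumn_swap n m f :
  sumn n (fun i => sumn m (fun j => f i j)) = sumn m (fun j => sumn n (fun i => f i j)).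
Proof.
  induction n; simpl.
  - now rewrite sumn_const, Nat.mul_0_r.
  - now rewrite IHn, <- sumn_add.
Qed.

Lemma sumn_term n f i : i < n -> f i <= sumn n f.
Proof.
  induction n; simpl; intros; [lia|].
  destruct (Nat.eq_dec i n); [subst|assert (f i <= sumn n f) by (apply IHn; lia)]; lia.
Qed.

Lemma sumn_split n k f : sumn (n + k) f = sumn n f + sumn k (fun i => f (n + i)).
Proof.
  induction k; simpl; [rewrite Nat.add_0_r; lia|].
  rewrite Nat.add_succ_r; simpl. lia.
Qed.

Lemma sumn_single n f i : i < n -> (forall j, j < n -> j <> i -> f j = 0) -> sumn n f = f i.
Proof.
  induction n; simpl; intros Hi H; [lia|].
  destruct (Nat.eq_dec i n).
  - subst. rewrite sumn_zero; auto. intros; apply H; lia.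
  - rewrite (H n), IHn by (auto; lia). lia.
Qed.

Lemma cnt_mono n p q : (forall i, i < n -> p i = true -> q i = true) -> cnt n p <= cnt n q.
Proof.
  intros H. apply sumn_le. intros i Hi. specialize (H i Hi).
  destruct (p i); [rewrite H by auto|]; simpl; lia.
Qed.

Lemma cnt_ext n p q : (forall i, i < n -> p i = q i) -> cnt n p = cnt n q.
Proof. intros H. apply sumn_ext. intros i Hi. now rewrite H. Qed.

Lemma cnt_bound n p : cnt n p <= n.
Proof.
  unfold cnt. etransitivity; [apply (sumn_le n _ (fun _ => 1))|].
  - intros. destruct (p i); simpl; lia.
  - rewrite sumn_const; lia.
Qed.

Lemma cnt_unique n p : (forall i j, i < n -> j < n -> p i = true -> p j = true -> i = j) ->
  cnt n p <= 1.
Proof.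
  unfold cnt. induction n; simpl; intros H; [lia|]. destruct (p n) eqn:E; simpl.
  - rewrite sumn_zero; [lia|]. intros i Hi. destruct (p i) eqn:Ei; auto.
    assert (i = n) by (apply H; auto; lia). lia.
  - rewrite Nat.add_0_r. apply IHn. intros; apply H; auto.
Qed.

Lemma exbP n p : exb n p = true <-> exists i, i < n /\ p i = true.
Proof.
  unfold exb. rewrite Nat.ltb_lt. split.
  - intros H. apply NNPP. intros N. unfold cnt in H. rewrite sumn_zero in H; [lia|].
    intros i Hi. destruct (p i) eqn:E; auto. exfalso; eauto.
  - intros (i & Hi & E). assert (H := sumn_term n (fun i => Nat.b2n (p i)) i Hi).
    cbn beta in H. rewrite E in H. exact H.
Qed.

Lemma exb_false n p : exb n p = false <-> forall i, i < n -> p i = false.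
Proof.
  rewrite <- not_true_iff_false, exbP. split.
  - intros N i Hi. apply not_true_is_false. eauto.
  - intros H (i & Hi & E). rewrite H in E; auto; discriminate.
Qed.

Lemma allbP n p : allb n p = true <-> forall i, i < n -> p i = true.
Proof.
  unfold allb. rewrite negb_true_iff, exb_false. split; intros H i Hi.
  - now apply negb_false_iff, H.
  - now apply negb_false_iff, H.
Qed.

Lemma least_spec n p i : i < n -> p i = true ->
  least n p <= i /\ p (least n p) = true.
Proof.
  intros Hi Ep.
  assert (H : (least n p < n /\ p (least n p) = true /\
    (forall j, j < least n p -> p j = false)) \/
    (least n p = n /\ (forall j, j < n -> p j = false))).
  { clear. induction n; simpl; [right; split; auto; lia|].
    destruct IHn as [(H1 & H2 & H3)|(H1 & H2)].
    - rewrite (proj2 (Nat.ltb_lt _ _) H1). left; auto.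
    - rewrite H1, Nat.ltb_irrefl. destruct (p n) eqn:E; [left|right]; auto.
      split; auto. intros j Hj. destruct (Nat.eq_dec j n); [subst; auto|apply H2; lia]. }
  destruct H as [(H1 & H2 & H3)|(H1 & H2)].
  - split; auto. apply Nat.nlt_ge. intros L. rewrite H3 in Ep; auto; discriminate.
  - rewrite H2 in Ep; auto; discriminate.
Qed.

Lemma least_unique n p i : i < n -> p i = true ->
  (forall j, j < n -> p j = true -> j = i) -> least n p = i.
Proof.
  intros Hi Ep U. destruct (least_spec n p i Hi Ep). apply U; auto. lia.
Qed.

Lemma cnt_filter n p : cnt n p = length (filter p (seq 0 n)).
Proof.
  induction n; auto. rewrite seq_S, filter_app, length_app, <- IHn.
  unfold cnt. simpl. now destruct (p n).
Qed.

Lemma NoDup_cnt l n p : NoDup l -> (forall i, In i l -> i < n /\ p i = true) ->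
  length l <= cnt n p.
Proof.
  intros D H. rewrite cnt_filter. apply NoDup_incl_length; auto.
  intros i Hi. destruct (H i Hi). apply filter_In. split; auto.
  apply in_seq. lia.
Qed.

(** The quotient counts the positive multiples of the divisor up to the dividend; the divisor 0 is
    separated, where division returns 0. *)
Lemma pr_div O a b : pr O a -> pr O b -> pr O (fun x => a x / b x).
Proof.
  intros Ha Hb. apply pr_ext with
    (fun x => if b x =? 0 then 0 else cnt (a x) (fun i => S i * b x <=? a x)).
  - intros x. destruct (Nat.eqb_spec (b x) 0) as [->|N]; [reflexivity|].
    generalize dependent (b x). intros d Nd. generalize (a x). intros k.
    assert (H : forall j, cnt j (fun i => S i * d <=? k) = Nat.min j (k / d)).
    { induction j; [reflexivity|]. unfold cnt in *. cbn [sumn]. rewrite IHj.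
      destruct (Nat.leb_spec (S j * d) k) as [L|L]; cbn [Nat.b2n].
      - assert (S j <= k / d) by (apply Nat.div_le_lower_bound; lia). lia.
      - assert (k / d < S j) by (apply Nat.Div0.div_lt_upper_bound; lia). lia. }
    rewrite H. assert (k / d <= k) by (apply Nat.Div0.div_le_upper_bound; nia). lia.
  - apply pr_ifz; try prim.
    apply (pr_cnt O a (fun x i => S i * b x <=? a x)); [prim|].
    apply prb_leb; [apply pr_mul; prim|prim].
Qed.

Lemma pr_mod O a b : pr O a -> pr O b -> pr O (fun x => a x mod b x).
Proof.
  intros. apply pr_ext with (fun x => a x - b x * (a x / b x)).
  - intros. apply Nat.Div0.mod_eq.
  - apply pr_sub, pr_mul, pr_div; prim.
Qed.

Ltac pr_user := fail.

Ltac prs :=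
  cbv beta;
  first [ assumption | apply pr_fst0 | apply pr_snd0 | lazymatch goal with
  | |- pr _ (fun x => x) => apply pr_id
  | |- pr _ (fun _ => ?k) => apply pr_const
  | |- pr _ (fun x => S _) => apply pr_S; prs
  | |- pr _ (fun x => pred _) => apply pr_pred; prs
  | |- pr _ (fun x => pi1 _) => apply pr_pi1; prs
  | |- pr _ (fun x => pi2 _) => apply pr_pi2; prs
  | |- pr _ (fun x => cpair _ _) => apply pr_cpair; prs
  | |- pr _ (fun x => _ + _) => apply pr_add; prs
  | |- pr _ (fun x => _ - _) => apply pr_sub; prs
  | |- pr _ (fun x => _ * _) => apply pr_mul; prs
  | |- pr _ (fun x => _ ^ _) => apply pr_pow; prs
  | |- pr _ (fun x => _ / _) => apply pr_div; prs
  | |- pr _ (fun x => _ mod _) => apply pr_mod; prs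
  | |- pr _ (fun x => sumn _ _) => apply pr_sumn; prs
  | |- pr _ (fun x => cnt _ _) => apply pr_cnt; prs
  | |- pr _ (fun x => least _ _) => apply pr_least; prs
  | |- pr _ (fun x => Nat.iter _ _ _) => apply pr_iter; prs
  | |- pr _ (fun x => Nat.b2n (_ && _)) => apply prb_andb; prs
  | |- pr _ (fun x => Nat.b2n (_ || _)) => apply prb_orb; prs
  | |- pr _ (fun x => Nat.b2n (negb _)) => apply prb_negb; prs
  | |- pr _ (fun x => Nat.b2n (_ =? _)) => apply prb_eqb; prs
  | |- pr _ (fun x => Nat.b2n (_ <=? _)) => apply prb_leb; prs
  | |- pr _ (fun x => Nat.b2n (_ <? _)) => apply prb_ltb; prs
  | |- pr _ (fun x => Nat.b2n (exb _ _)) => apply prb_exb; prs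
  | |- pr _ (fun x => Nat.b2n (allb _ _)) => apply prb_allb; prs
  | |- pr _ (fun x => Nat.b2n (if _ then _ else _)) => apply prb_if; prs
  | |- pr _ (fun x => if _ then _ else _) => apply pr_if; prs
  | _ => fail
  end
  | pr_user
  | match goal with H : pr ?O ?b |- pr ?O (fun x => ?b (@?g x)) =>
      apply (pr_comp O b g H); prs end
  | match goal with H : forall O, pr O ?b |- pr ?O (fun x => ?b (@?g x)) =>
      apply (pr_comp O b g (H O)); prs end ].

(** * Decoding the pairing [npair] *)

Lemma pow2_pos k : 1 <= 2 ^ k.
Proof. induction k; simpl; lia. Qed.

Lemma npair_inj a b c d : npair a b = npair c d -> a = c /\ b = d.
Proof.
  unfold npair. intros H.
  assert (E : 2 ^ a * (2 * b + 1) = 2 ^ c * (2 * d + 1)).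
  { assert (Ha := pow2_pos a). assert (Hc := pow2_pos c). nia. }
  clear H. revert c E. induction a as [|a IH]; intros [|c] E.
  - simpl in E; lia.
  - rewrite Nat.pow_succ_r' in E. simpl (2 ^ 0) in E. lia.
  - rewrite Nat.pow_succ_r' in E. simpl (2 ^ 0) in E. lia.
  - rewrite !Nat.pow_succ_r' in E. destruct (IH c); [lia|]. split; lia.
Qed.

Lemma npair_ge a b : a <= npair a b /\ b <= npair a b.
Proof.
  unfold npair. assert (H : S a <= 2 ^ a) by (induction a; simpl; lia).
  split; nia.
Qed.

(** Both components are at most the code, so bounded search inverts the pairing and primitive
    recursiveness comes for free. *)
Definition npfst z := least (S z) (fun a => exb (S z) (fun b => npair a b =? z)).
Definition npsnd z := least (S z) (fun b => exb (S z) (fun a => npair a b =? z)).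

Lemma npfst_npair a b : npfst (npair a b) = a.
Proof.
  assert (H := npair_ge a b). apply least_unique; [lia| |].
  - apply exbP. exists b. split; [lia|]. apply Nat.eqb_refl.
  - intros j _ H1. apply exbP in H1 as (i & _ & H1). apply Nat.eqb_eq, npair_inj in H1.
    tauto.
Qed.

Lemma npsnd_npair a b : npsnd (npair a b) = b.
Proof.
  assert (H := npair_ge a b). apply least_unique; [lia| |].
  - apply exbP. exists a. split; [lia|]. apply Nat.eqb_refl.
  - intros j _ H1. apply exbP in H1 as (i & _ & H1). apply Nat.eqb_eq, npair_inj in H1.
    tauto.
Qed.

Lemma pr_npair O a b : pr O a -> pr O b -> pr O (fun x => npair (a x) (b x)).
Proof. intros. unfold npair. prs. Qed.

Lemma pr_npfst O a : pr O a -> pr O (fun x => npfst (a x)).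
Proof. intros. unfold npfst, npair. prs. Qed.

Lemma pr_npsnd O a : pr O a -> pr O (fun x => npsnd (a x)).
Proof. intros. unfold npsnd, npair. prs. Qed.

(** * String codes *)

Lemma str_code_length s : 2 ^ length s <= str_code s + 1 < 2 ^ S (length s).
Proof.
  induction s as [|b s IH]; simpl in *; [lia|]. destruct b; lia.
Qed.

Lemma str_code_lt s k : length s <= k -> str_code s < 2 ^ S k.
Proof.
  intros. assert (L := str_code_length s).
  assert (2 ^ S (length s) <= 2 ^ S k) by (apply Nat.pow_le_mono_r; lia). lia.
Qed.

Lemma str_length_le s k : str_code s + 1 < 2 ^ S k -> length s <= k.
Proof.
  intros. assert (L := str_code_length s).
  assert (length s < S k); [|lia]. apply (Nat.pow_lt_mono_r_iff 2); lia.
Qed.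

Lemma str_code_inj s t : str_code s = str_code t -> s = t.
Proof.
  revert t. induction s as [|b s IH]; intros [|c t] E; simpl in E; auto.
  - destruct c; lia.
  - destruct b; lia.
  - destruct b, c; try lia; f_equal; apply IH; lia.
Qed.

Lemma str_code_surj z : exists s, str_code s = z.
Proof.
  induction z as [z IH] using lt_wf_ind.
  destruct z as [|z]; [exists nil; auto|].
  pose proof (Nat.div_mod_eq z 2) as E.
  pose proof (Nat.mod_upper_bound z 2 ltac:(lia)) as L.
  destruct (IH (z / 2)) as [s Hs]; [generalize dependent (z / 2); intros; lia|].
  exists ((z mod 2 =? 1) :: s). cbn [str_code]. rewrite Hs.
  destruct (Nat.eqb_spec (z mod 2) 1); lia.
Qed.

Lemma str_code_app s t : str_code (s ++ t) = str_code s + 2 ^ length s * str_code t.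
Proof. induction s as [|b s IH]; simpl; [lia|]. rewrite IH. lia. Qed.

(** The strings of length k have exactly the codes from 2^k - 1 to 2^(k+1) - 2, so this is the
    length of the string coded by [u]. *)
Definition slen u := least (S u) (fun k => S u <? 2 ^ S k).

(* The [i]-th letter of the string coded by [u] is bit [i] of [u+1]; doubling it
   contributes the digit at positions [2i] and [2i+1]. *)
Definition dbl u := sumn (slen u) (fun i => (1 + (S u / 2 ^ i) mod 2) * (3 * 4 ^ i)).

(** The arithmetic of [str_pair]: [4 * v + 5] codes the separator followed by the string of [v], and
    [4 ^ slen u] shifts it past the doubled letters. *)
Definition spair u v := dbl u + 4 ^ slen u * (4 * v + 5).

Lemma slen_code s : slen (str_code s) = length s.
Proof.
  assert (L := str_code_length s).
  apply Nat.le_antisymm.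
  - apply least_spec.
    + assert (length s < 2 ^ length s) by (apply Nat.pow_gt_lin_r; lia). lia.
    + apply Nat.ltb_lt. lia.
  - assert (Hk : slen (str_code s) < S (str_code s) /\
      S (str_code s) < 2 ^ S (slen (str_code s))).
    { assert (length s < 2 ^ length s) by (apply Nat.pow_gt_lin_r; lia).
      destruct (least_spec (S (str_code s)) (fun k => S (str_code s) <? 2 ^ S k) (length s)).
      - lia.
      - apply Nat.ltb_lt. lia.
      - split; [unfold slen; lia|]. now apply Nat.ltb_lt. }
    destruct Hk as [_ Hk].
    assert (length s < S (slen (str_code s))); [|lia].
    apply (Nat.pow_lt_mono_r_iff 2); lia.
Qed.

Lemma sumn_head n f : sumn (S n) f = f 0 + sumn n (fun i => f (S i)).
Proof. rewrite (sumn_split 1 n). simpl. lia. Qed.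

Lemma dbl_code s : dbl (str_code s) = str_code (double_bits s).
Proof.
  unfold dbl. rewrite slen_code. induction s as [|b s IH]; [reflexivity|].
  cbn [length]. rewrite sumn_head.
  set (u := str_code (b :: s)). cbn [double_bits str_code]. rewrite <- IH.
  assert (E : S u / 2 = S (str_code s)).
  { unfold u; cbn [str_code]. symmetry.
    destruct b; [apply Nat.div_unique with 1 | apply Nat.div_unique with 0]; lia. }
  assert (E0 : S u mod 2 = if b then 1 else 0).
  { unfold u; cbn [str_code]. symmetry.
    destruct b; [apply Nat.mod_unique with (S (str_code s))
                |apply Nat.mod_unique with (S (str_code s))]; lia. }
  rewrite (sumn_ext _ _ (fun i => 4 * ((1 + (S (str_code s) / 2 ^ i) mod 2) * (3 * 4 ^ i)))).
  - rewrite sumn_mul, Nat.pow_0_r, Nat.div_1_r, E0. destruct b; cbn [Nat.pow]; lia.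
  - intros i _. rewrite !Nat.pow_succ_r', <- Nat.Div0.div_div, E. lia.
Qed.

Lemma double_bits_length s : length (double_bits s) = 2 * length s.
Proof. induction s; simpl; lia. Qed.

Lemma spair_code s t : spair (str_code s) (str_code t) = str_code (str_pair s t).
Proof.
  unfold spair, str_pair.
  rewrite str_code_app, dbl_code, slen_code, double_bits_length, Nat.pow_mul_r.
  simpl str_code. change (2 ^ 2) with 4. lia.
Qed.

Lemma str_pair_inj s t s' t' : str_pair s t = str_pair s' t' -> s = s' /\ t = t'.
Proof.
  unfold str_pair. revert s'. induction s as [|b s IH]; intros [|c s'] E; simpl in E.
  - injection E as ->. auto.
  - injection E as <- E1 _. discriminate.
  - injection E as -> E1 _. discriminate.
  - injection E as -> _ E. destruct (IH _ E) as [-> ->]. auto.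
Qed.

Lemma str_pair_ge s t :
  str_code s <= str_code (str_pair s t) /\ str_code t <= str_code (str_pair s t).
Proof.
  unfold str_pair. induction s as [|b s IH]; simpl in *; [lia|]. destruct b; lia.
Qed.

Definition sfst z := least (S z) (fun a => exb (S z) (fun b => spair a b =? z)).
Definition ssnd z := least (S z) (fun b => exb (S z) (fun a => spair a b =? z)).

Lemma spair_inj a b c d : spair a b = spair c d -> a = c /\ b = d.
Proof.
  destruct (str_code_surj a) as [sa <-], (str_code_surj b) as [sb <-],
    (str_code_surj c) as [sc <-], (str_code_surj d) as [sd <-].
  rewrite !spair_code. intros H. apply str_code_inj, str_pair_inj in H as [-> ->]. auto.
Qed.

Lemma spair_ge a b : a <= spair a b /\ b <= spair a b.
Proof.
  destruct (str_code_surj a) as [sa <-], (str_code_surj b) as [sb <-].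
  rewrite spair_code. apply str_pair_ge.
Qed.

Lemma sfst_spair a b : sfst (spair a b) = a.
Proof.
  assert (H := spair_ge a b). apply least_unique; [lia| |].
  - apply exbP. exists b. split; [lia|]. apply Nat.eqb_refl.
  - intros j _ H1. apply exbP in H1 as (i & _ & H1). apply Nat.eqb_eq, spair_inj in H1.
    tauto.
Qed.

Lemma ssnd_spair a b : ssnd (spair a b) = b.
Proof.
  assert (H := spair_ge a b). apply least_unique; [lia| |].
  - apply exbP. exists a. split; [lia|]. apply Nat.eqb_refl.
  - intros j _ H1. apply exbP in H1 as (i & _ & H1). apply Nat.eqb_eq, spair_inj in H1.
    tauto.
Qed.

Lemma pr_spair O a b : pr O a -> pr O b -> pr O (fun x => spair (a x) (b x)).
Proof. intros. unfold spair, dbl, slen. prs. Qed.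

Ltac pr_user ::= first [ apply pr_npair; prs | apply pr_npfst; prs | apply pr_npsnd; prs
  | apply pr_spair; prs ].

Lemma pr_sfst O a : pr O a -> pr O (fun x => sfst (a x)).
Proof. intros. unfold sfst. prs. Qed.

Lemma pr_ssnd O a : pr O a -> pr O (fun x => ssnd (a x)).
Proof. intros. unfold ssnd. prs. Qed.

Ltac pr_user ::= first [ apply pr_npair; prs | apply pr_npfst; prs | apply pr_npsnd; prs
  | apply pr_spair; prs | apply pr_sfst; prs | apply pr_ssnd; prs ].

(** * Step-bounded simulation of a fixed oracle-free program *)

(* A natural number codes an infinite sequence of register contents, almost all 0. *)
Fixpoint get (i z : nat) : nat :=
  match i with 0 => pi1 z | S i => get i (pi2 z) end.

Fixpoint set (i z v : nat) : nat :=
  match i with 0 => cpair v (pi2 z) | S i => cpair (pi1 z) (set i (pi2 z) v) end.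

Lemma get_set i z v j : get j (set i z v) = if j =? i then v else get j z.
Proof.
  revert z j. induction i as [|i IH]; intros z [|j]; simpl;
    rewrite ?pi1_cpair, ?pi2_cpair; auto.
Qed.

Lemma get_zero i : get i 0 = 0.
Proof. induction i; auto. Qed.

(** A query is answered by 0, since the simulated runs use [no_oracle]. *)
Definition sim_instr (i : instr) (pc z : nat) : nat :=
  match i with
  | INC r => cpair (S pc) (set r z (S (get r z)))
  | DEC r j => if get r z =? 0 then cpair j z
               else cpair (S pc) (set r z (pred (get r z)))
  | ORC r => cpair (S pc) (set r z 0)
  end.

Definition sim_step (P : prog) (c : nat) : nat :=
  match nth_error P (pi1 c) with
  | None => c
  | Some i => sim_instr i (pi1 c) (pi2 c)
  end.

Definition sim P t x := Nat.iter t (sim_step P) (cpair 0 (cpair x 0)).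

(* [S x] if [P] has stopped with output [x] after at most [t] steps, 0 otherwise. *)
Definition ueval P t p y : nat :=
  if length P <=? pi1 (sim P t (npair p y)) then S (get 0 (pi2 (sim P t (npair p y))))
  else 0.

Definition rep (c : nat) (z : nat * regs) : Prop :=
  pi1 c = fst z /\ forall i, get i (pi2 c) = snd z i.

Lemma rep_step P c z z' :
  rep c z -> step no_oracle P z z' -> rep (sim_step P c) z'.
Proof.
  intros [H1 H2] Hs. unfold sim_step. rewrite H1.
  destruct Hs as [pc r r0 E | pc r r0 j E Z | pc r r0 j k E Z
    | pc r r0 E N | pc r r0 E N]; simpl in *; rewrite E; unfold sim_instr; rewrite ?H2.
  - split; rewrite ?pi1_cpair, ?pi2_cpair; simpl; auto;
      try (intros i; rewrite pi2_cpair; apply H2).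
    intros i; rewrite get_set, H2. reflexivity.
  - rewrite Z; cbn [Nat.eqb pred]; split; rewrite ?pi1_cpair, ?pi2_cpair; simpl; auto;
      try (intros i; rewrite pi2_cpair; apply H2).
  - rewrite Z; cbn [Nat.eqb pred]; split; rewrite ?pi1_cpair, ?pi2_cpair; simpl; auto;
      try (intros i; rewrite pi2_cpair; apply H2).
    intros i; rewrite get_set, H2. reflexivity.
  - destruct N.
  - split; rewrite ?pi1_cpair, ?pi2_cpair; simpl; auto;
      try (intros i; rewrite pi2_cpair; apply H2).
    intros i; rewrite get_set, H2. reflexivity.
Qed.

Lemma step_exists P z i : nth_error P (fst z) = Some i ->
  exists z', step no_oracle P z z'.
Proof.
  destruct z as [pc r]; simpl; intros E. destruct i as [r0|r0 j|r0].
  - eexists; apply st_inc; eauto.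
  - destruct (r r0) eqn:Z; eexists; [eapply st_dec0|eapply st_decS]; eauto.
  - eexists; eapply st_orc0; eauto.
Qed.

Lemma rep_init x : rep (cpair 0 (cpair x 0)) (0, init_regs x).
Proof.
  split; rewrite ?pi1_cpair, ?pi2_cpair; simpl; auto.
  intros [|i]; simpl; rewrite ?pi1_cpair, ?pi2_cpair; auto. apply get_zero.
Qed.

Lemma sim_steps P t x : exists z, steps no_oracle P (0, init_regs x) z /\
  rep (sim P t x) z.
Proof.
  induction t as [|t (z & Hs & Hr)].
  - exists (0, init_regs x). split; [constructor | apply rep_init].
  - destruct (nth_error P (fst z)) as [i|] eqn:E.
    + destruct (step_exists _ _ _ E) as [z' Hz]. exists z'. split.
      * eapply steps_trans; [eauto|]. econstructor; [eauto|constructor].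
      * exact (rep_step _ _ _ _ Hr Hz).
    + exists z. split; auto. simpl. unfold sim_step.
      now rewrite (proj1 Hr), E.
Qed.

Lemma steps_sim P c z z' : rep c z -> steps no_oracle P z z' ->
  exists t, rep (Nat.iter t (sim_step P) c) z'.
Proof.
  intros Hr Hs. revert c Hr. induction Hs as [z|z1 z2 z3 H1 H2 IH]; intros c Hr.
  - now exists 0.
  - destruct (IH _ (rep_step _ _ _ _ Hr H1)) as [t Ht]. exists (S t).
    now rewrite Nat.iter_succ_r.
Qed.

Lemma ueval_computes P p y x :
  computes no_oracle P (npair p y) x <-> exists t, ueval P t p y = S x.
Proof.
  unfold ueval. split.
  - intros (pc & r & Hs & N & E).
    destruct (steps_sim _ _ _ _ (rep_init _) Hs) as [t [H1 H2]]. exists t.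
    unfold sim. rewrite H1, H2. simpl. apply nth_error_None in N.
    rewrite (proj2 (Nat.leb_le _ _) N). now f_equal.
  - intros [t Ht]. destruct (Nat.leb_spec (length P) (pi1 (sim P t (npair p y)))) as [L|L];
      [|discriminate].
    destruct (sim_steps P t (npair p y)) as ([pc r] & Hs & H1 & H2). simpl in *.
    exists pc, r. repeat split; auto.
    + apply nth_error_None. lia.
    + rewrite <- H2. now injection Ht.
Qed.

Lemma ueval_mono P t t' p y x : t <= t' -> ueval P t p y = S x -> ueval P t' p y = S x.
Proof.
  intros L E. replace t' with ((t' - t) + t) by lia. generalize (t' - t).
  intros d. revert E. unfold ueval.
  destruct (Nat.leb_spec (length P) (pi1 (sim P t (npair p y)))) as [H|H];
      [|discriminate].
  intros E. assert (Hd : sim P (d + t) (npair p y) = sim P t (npair p y)).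
  { induction d as [|d IH]; auto. unfold sim in *. simpl. rewrite IH.
    unfold sim_step at 1. now rewrite (proj2 (nth_error_None _ _) H). }
  now rewrite Hd, (proj2 (Nat.leb_le _ _) H).
Qed.

Lemma ueval_fun P t t' p y x x' :
  ueval P t p y = S x -> ueval P t' p y = S x' -> x = x'.
Proof.
  intros E E'.
  assert (H := ueval_mono P t (t + t') p y x ltac:(lia) E).
  assert (H' := ueval_mono P t' (t + t') p y x' ltac:(lia) E'). congruence.
Qed.

Lemma pr_get O i a : pr O a -> pr O (fun x => get i (a x)).
Proof. revert a. induction i; intros a Ha; simpl; [prs|]. apply IHi. prs. Qed.

Lemma pr_set O i a v : pr O a -> pr O v -> pr O (fun x => set i (a x) (v x)).
Proof.
  revert a. induction i; intros a Ha Hv; simpl; [prs|]. apply pr_cpair; [prs|].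
  apply (IHi (fun x => pi2 (a x))); prs.
Qed.

Lemma pr_sim_instr O i pc z : pr O pc -> pr O z ->
  pr O (fun x => sim_instr i (pc x) (z x)).
Proof.
  intros. destruct i as [r|r j|r]; simpl.
  - apply pr_cpair; [prs|]. apply pr_set; [prs|]. apply pr_S, pr_get; prs.
  - apply pr_ifz; [apply pr_get; prs | prs |].
    apply pr_cpair; [prs|]. apply pr_set; [prs|]. apply pr_pred, pr_get; prs.
  - apply pr_cpair; [prs|]. apply pr_set; prs.
Qed.

(** The program is fixed, so the dispatch on the program counter unfolds into a finite nest of case
    distinctions. *)
Lemma pr_sim_step O P a : pr O a -> pr O (fun x => sim_step P (a x)).
Proof.
  intros Ha. unfold sim_step.
  assert (H : forall n, pr O n -> pr O (fun x =>
    match nth_error P (n x) with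
    | None => a x | Some i => sim_instr i (pi1 (a x)) (pi2 (a x)) end)).
  { induction P as [|i P IH]; intros n Hn.
    - apply pr_ext with a; auto. intros x. now destruct (n x).
    - apply pr_ext with (fun x => if n x =? 0 then sim_instr i (pi1 (a x)) (pi2 (a x))
        else match nth_error P (pred (n x)) with
        | None => a x | Some i => sim_instr i (pi1 (a x)) (pi2 (a x)) end).
      + intros x. now destruct (n x).
      + apply pr_ifz; [prs | apply pr_sim_instr; prs |].
        apply (IH (fun x => pred (n x))). prs. }
  apply (H (fun x => pi1 (a x))). prs.
Qed.

Lemma pr_ueval O P t p y : pr O t -> pr O p -> pr O y ->
  pr O (fun x => ueval P (t x) (p x) (y x)).
Proof.
  intros. unfold ueval, sim.
  assert (Hs : pr O (fun x => Nat.iter (t x) (sim_step P)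
    (cpair 0 (cpair (npair (p x) (y x)) 0)))).
  { apply pr_iter; [prs | prs |]. apply pr_sim_step. prs. }
  apply pr_if; [prs|..]; [|prs]. apply pr_S, (pr_get O 0). prs.
Qed.

(** * Reduction of existential statements to the halting set *)

(** Coding onto a given tail turns concatenation of programs into composition of functions, which
    keeps the code of compiled commands primitive recursive. *)
Definition prog_code_onto (P : prog) (rest : nat) : nat :=
  fold_right (fun i z => S (npair (instr_code i) z)) rest P.

Lemma prog_code_app P P' : prog_code (P ++ P') = prog_code_onto P (prog_code P').
Proof. induction P; simpl; congruence. Qed.

Lemma pr_prog_code_onto O c a rest : pr O a -> pr O rest ->
  pr O (fun x => prog_code_onto (compile (a x) c) (rest x)).
Proof.
  revert a rest.
  assert (Happ : forall P P' r, prog_code_onto (P ++ P') r =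
    prog_code_onto P (prog_code_onto P' r)) by (intros; apply fold_right_app).
  induction c as [|r|r|c IHc d IHd|r c IHc d IHd|r c IHc]; intros a rest Ha Hr; simpl.
  - prs.
  - prs.
  - prs.
  - apply pr_ext with (fun x => prog_code_onto (compile (a x) c)
      (prog_code_onto (compile (a x + clen c) d) (rest x))).
    + intros. apply Happ.
    + apply IHc; [prs|]. apply (IHd (fun x => a x + clen c)); prs.
  - apply pr_ext with (fun x => S (npair (3 * npair r (a x + clen c + 2) + 1)
      (prog_code_onto (compile (S (a x)) c)
        (S (npair (3 * npair 1 (a x + clen c + clen d + 2) + 1)
          (prog_code_onto (compile (a x + clen c + 2) d) (rest x))))))).
    + intros. unfold instr_code. now rewrite Happ.
    + apply pr_S, pr_npair; [prs|]. apply (IHc (fun x => S (a x))); [prs|].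
      apply pr_S, pr_npair; [prs|]. apply (IHd (fun x => a x + clen c + 2)); prs.
  - apply pr_ext with (fun x => S (npair (3 * npair r (a x + clen c + 2) + 1)
      (prog_code_onto (compile (S (a x)) c)
        (S (npair (3 * npair 1 (a x) + 1) (rest x)))))).
    + intros. unfold instr_code. now rewrite Happ.
    + apply pr_S, pr_npair; [prs|]. apply (IHc (fun x => S (a x))); prs.
Qed.

Lemma steps_load O x k post :
  steps O (repeat (INC 0) (k + x) ++ post) (k, init_regs k) (k + x, init_regs (k + x)).
Proof.
  revert k. induction x as [|x IH]; intros k.
  - rewrite Nat.add_0_r. constructor.
  - eapply steps_step.
    + apply st_inc with (r := 0). rewrite nth_error_app1.
      * apply nth_error_repeat. lia.
      * rewrite repeat_length. lia.
    + replace (upd (init_regs k) 0 (S (init_regs k 0))) with (init_regs (S k)).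
      * rewrite <- Nat.add_succ_comm. apply IH.
      * apply functional_extensionality. intros [|i]; reflexivity.
Qed.

(** The halting set concerns runs on input 0, so the input is hard-wired: [x] increments of register
    0 come first and the search is compiled at address [x]. Its code is then a primitive recursive
    function of [x]. *)
Theorem halting_reduction O nq : pr no_oracle (fun z => nq (pi1 z) (pi2 z)) ->
  exists e, pr O e /\ forall x, halting_set (e x) <-> exists w, nq x w = 0.
Proof.
  intros Hq. destruct (search_cmd _ nq (fun _ _ => 0) Hq (pr_zero _))
    as (c & Wc & Hy & Hn).
  set (H := fun x => repeat (INC 0) x ++ compile x c).
  assert (Lrep : forall x, length (repeat (INC 0) x) = x) by (intros; apply repeat_length).
  exists (fun x => prog_code (H x)). split.
  - apply pr_ext with (fun x => Nat.iter x (fun z => S (npair 0 z))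
      (prog_code_onto (compile x c) 0)).
    + intros x. unfold H. rewrite prog_code_app.
      replace (prog_code (compile x c)) with (prog_code_onto (compile x c) 0).
      * generalize (prog_code_onto (compile x c) 0). intros z. clear.
        induction x; simpl; congruence.
      * generalize (compile x c). intros P. clear. induction P; simpl; congruence.
    + apply (pr_iter O (fun x => x) (fun x => prog_code_onto (compile x c) 0)
        (fun _ z => S (npair 0 z))); [prs| |prs].
      apply (pr_prog_code_onto O c (fun x => x) (fun _ => 0)); prs.
  - intros x.
    assert (S0 : steps no_oracle (H x) (0, init_regs 0) (x, init_regs x)).
    { apply (steps_load no_oracle x 0). }
    assert (I0 : init_regs 0 = fun _ => 0).
    { apply functional_extensionality. intros [|i]; reflexivity. }
    split.
    + intros (P & EP & y & pc & r & Hs & N & _).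
      assert (P = H x) as ->.
      { assert (Hcode : forall i j, instr_code i = instr_code j -> i = j).
        { intros [a|a b|a] [a'|a' b'|a'] E; simpl in E; try lia; f_equal; try lia.
          - assert (E' : npair a b = npair a' b') by lia. apply npair_inj in E'; tauto.
          - assert (E' : npair a b = npair a' b') by lia. apply npair_inj in E'; tauto. }
        clear - EP Hcode. revert EP. generalize (H x). intros Q. revert Q.
        induction P as [|i P IH]; intros [|j Q] E; simpl in E; try discriminate; auto.
        injection E as E. apply npair_inj in E as [E1 E2]. f_equal; auto. }
      apply NNPP. intros NE.
      assert (Hs' := steps_to_halt _ _ _ _ _ S0 Hs N).
      apply (Hn x) with (pre := repeat (INC 0) x) (post := nil) (ch := (pc, r)).
      * intros w E. apply NE. now exists w.
      * rewrite Lrep, app_nil_r. exact Hs'.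
      * rewrite Lrep, app_nil_r. exact N.
    + intros Hw. exists (H x). split; auto.
      destruct (dec_inh_nat_subset_has_unique_least_element (fun w => nq x w = 0))
        as (w & (Hw1 & Hw2) & _); [intros; destruct (nq x n); auto|exact Hw|].
      destruct (Hy x w Hw1) as (r & Hr & E0).
      { intros w' L E. apply Hw2 in E. lia. }
      exists (r 0), (x + clen c), r. repeat split; auto.
      * eapply steps_trans; [exact S0|].
        rewrite <- (app_nil_r (H x)). unfold H. rewrite <- app_assoc.
        apply compile_correct; auto.
      * apply nth_error_None. unfold H. rewrite length_app, compile_length, Lrep. lia.
Qed.

Corollary halting_decides nq : pr no_oracle (fun z => nq (pi1 z) (pi2 z)) ->
  exists o : nat -> bool, prb halting_set o /\
    forall x, o x = true <-> exists w, nq x w = 0.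
Proof.
  intros Hq. destruct (halting_reduction halting_set nq Hq) as (e & He & E).
  set (h := fun x => if excluded_middle_informative (halting_set x) then true else false).
  exists (fun x => h (e x)). split.
  - apply (pr_comp halting_set (fun x => Nat.b2n (h x)) e); auto. apply pr_oracle.
    intros x. unfold h. destruct (excluded_middle_informative (halting_set x)); auto.
  - intros x. rewrite <- E. unfold h.
    destruct (excluded_middle_informative (halting_set (e x))); split; auto; discriminate.
Qed.

(** * Upper bounds for Kolmogorov complexity *)

(** Complexity is picked by [epsilon], hence it is meaningful only once some description is known to
    exist. *)
Lemma KSc_spec (U : cdecomp) q y x : U q y x ->
  (exists p, U p y x /\ length p = KSc U x y) /\
  (forall p, U p y x -> KSc U x y <= length p).
Proof.
  intros H. unfold KSc. apply epsilon_spec.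
  destruct (dec_inh_nat_subset_has_unique_least_element
    (fun k => exists p, U p y x /\ length p = k)) as (k & (H1 & H2) & _).
  - intros; apply classic.
  - eauto.
  - exists k. split; auto. intros p Hp. apply H2. eauto.
Qed.

Lemma optimal_search O U nq v : optimal O U ->
  pr O (fun z => nq (pi1 z) (pi2 z)) -> pr O (fun z => v (pi1 z) (pi2 z)) ->
  exists c, forall p y x w,
    nq (npair (str_code p) (str_code y)) w = 0 ->
    (forall w', w' < w -> nq (npair (str_code p) (str_code y)) w' <> 0) ->
    v (npair (str_code p) (str_code y)) w = str_code x ->
    exists q, U q y x /\ length q <= length p + c.
Proof.
  intros [_ HU] Hq Hv. destruct (search_cmd _ nq v Hq Hv) as (cm & W & Hy & _).
  set (P := compile 0 cm).
  destruct (HU (fun p y x => computes O P (npair (str_code p) (str_code y)) (str_code x)))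
    as [c Hc].
  - exists P. intros; reflexivity.
  - exists c. intros p y x w H1 H2 H3. apply Hc.
    destruct (Hy _ w H1 H2) as (r & Hr & E0).
    exists (clen cm), r. split; [|split].
    + pose proof (compile_correct _ _ _ _ Hr W eq_refl nil nil 0 eq_refl) as Hs.
      rewrite app_nil_r in Hs. exact Hs.
    + apply nth_error_None. unfold P. rewrite compile_length. lia.
    + congruence.
Qed.

(* An element of an enumerable family of at most [2^k] keys is described by its rank in
   the order of enumeration; the parameter [r < 2^b] is shipped with that rank. *)
Theorem enumeration_bound O U (W : nat -> nat -> bool) (out : nat -> nat -> nat) :
  optimal O U ->
  prb O (fun z => W (pi1 z) (pi2 z)) -> pr O (fun z => out (pi1 z) (pi2 z)) ->
  exists c, forall y x r b k w,
    r < 2 ^ b ->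
    (forall ks, NoDup ks ->
       (forall i, In i ks -> exists w, W (cpair (str_code y) r) w = true /\ pi2 w = i) ->
       length ks <= 2 ^ k) ->
    W (cpair (str_code y) r) w = true ->
    out (cpair (str_code y) r) (pi2 w) = str_code x ->
    exists q, U q y x /\ length q <= k + 2 * b + c.
Proof.
  intros HU HW Hout.
  (* A witness [w] counts only when its key [pi2 w] appears for the first time; the rank of a key is
     the number of such witnesses before it. *)
  set (first := fun z w => W z w && negb (exb w (fun w' => W z w' && (pi2 w' =? pi2 w)))).
  set (arg := fun x => cpair (npsnd x) (npsnd (npfst x) mod 2 ^ npfst (npfst x))).
  set (rank := fun x => npsnd (npfst x) / 2 ^ npfst (npfst x)).
  set (q := fun x w => first (arg x) w && (cnt w (first (arg x)) =? rank x)).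
  assert (PW : forall f g, pr O f -> pr O g -> prb O (fun x => W (f x) (g x))).
  { intros. apply (prb_comp2 O W); auto. }
  assert (Pf : forall f g, pr O f -> pr O g -> prb O (fun x => first (f x) (g x))).
  { intros f g Hf Hg. unfold first. apply prb_andb; [auto|]. apply prb_negb, prb_exb; auto.
    apply prb_andb; [apply PW; prs | prs]. }
  destruct (optimal_search O U (fun x w => Nat.b2n (negb (q x w)))
    (fun x w => out (arg x) (pi2 w)) HU) as [c Hc].
  { unfold q, rank, arg. apply prb_negb, prb_andb.
    - apply Pf; prs.
    - apply prb_eqb; [|prs]. apply pr_cnt; [prs|]. apply Pf; prs. }
  { unfold arg. apply (pr_comp2 O out); prs. }
  exists c. intros y x r b k w Hr HK Hw Hx.
  set (z := cpair (str_code y) r) in *.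
  destruct (dec_inh_nat_subset_has_unique_least_element
    (fun v => W z v = true /\ pi2 v = pi2 w)) as (w1 & ((W1 & E1) & Hmin) & _).
  { intros; apply classic. } { exists w; auto. }
  set (j := cnt w1 (first z)).
  assert (F1 : first z w1 = true).
  { unfold first. rewrite W1. simpl. apply negb_true_iff, exb_false. intros i Hi.
    apply not_true_is_false. intros H. apply andb_true_iff in H as [H1 H2].
    apply Nat.eqb_eq in H2. specialize (Hmin i (conj H1 (eq_trans H2 E1))). lia. }
  assert (Hj : j < 2 ^ k).
  { set (ks := map pi2 (filter (first z) (seq 0 (S w1)))).
    assert (length ks = S j).
    { unfold ks. rewrite length_map, <- cnt_filter. unfold cnt. simpl. rewrite F1.
      simpl. fold (cnt w1 (first z)). fold j. lia. }
    assert (length ks <= 2 ^ k); [|lia]. apply HK.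
    - unfold ks. clear - first. assert (D := seq_NoDup (S w1) 0).
      apply NoDup_map_NoDup_ForallPairs; [|now apply NoDup_filter].
      assert (H : forall a b, first z a = true -> first z b = true -> a < b -> pi2 a <> pi2 b).
      { intros a b Ha Hb L E. unfold first in Ha, Hb.
        apply andb_true_iff in Ha as [Ha _], Hb as [_ Hb].
        apply negb_true_iff in Hb. rewrite exb_false in Hb. specialize (Hb a L).
        rewrite Ha, E, Nat.eqb_refl in Hb. discriminate. }
      intros a b Ha Hb E. apply filter_In in Ha as [_ Ha], Hb as [_ Hb].
      destruct (Nat.lt_trichotomy a b) as [L|[L|L]]; auto.
      + destruct (H a b Ha Hb L E).
      + destruct (H b a Hb Ha L (eq_sym E)).
    - intros i Hi. unfold ks in Hi. apply in_map_iff in Hi as (v & Ev & Hv).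
      apply filter_In in Hv as [_ Hv]. exists v. split; auto.
      unfold first in Hv. now apply andb_true_iff in Hv as [Hv _]. }
  (* The description is self-delimiting: the first component of [npair] costs [b] bits to announce
     the width of [r], which itself takes another [b] bits, and the rank takes [k]. *)
  destruct (str_code_surj (npair b (j * 2 ^ b + r))) as [p Hp].
  assert (Earg : arg (npair (str_code p) (str_code y)) = z).
  { unfold arg, z. rewrite npsnd_npair, npfst_npair, Hp, npfst_npair, npsnd_npair.
    f_equal. rewrite Nat.add_comm, Nat.Div0.mod_add. now apply Nat.mod_small. }
  assert (Erank : rank (npair (str_code p) (str_code y)) = j).
  { unfold rank. rewrite npfst_npair, Hp, npfst_npair, npsnd_npair.
    rewrite Nat.div_add_l, Nat.div_small by lia. lia. }
  destruct (Hc p y x w1) as (q0 & Hq0 & L).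
  - unfold q. rewrite Earg, Erank, F1. unfold j. now rewrite Nat.eqb_refl.
  - intros w' L. unfold q. rewrite Earg, Erank.
    destruct (first z w') eqn:F; [|discriminate]. simpl.
    destruct (Nat.eqb_spec (cnt w' (first z)) j) as [E|]; [|discriminate].
    assert (cnt (S w') (first z) <= cnt w1 (first z)).
    { replace w1 with (S w' + (w1 - S w')) by lia. unfold cnt. rewrite sumn_split. lia. }
    unfold cnt in H. simpl in H. rewrite F in H. fold (cnt w' (first z)) in H.
    simpl in H. fold j in H. fold (cnt w1 (first z)) in H. fold j in H. lia.
  - now rewrite Earg, E1.
  - exists q0. split; auto. etransitivity; [exact L|]. apply Nat.add_le_mono_r.
    apply str_length_le. rewrite Hp. unfold npair.
    replace (S (k + 2 * b)) with (b + (b + (k + 1))) by lia.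
    rewrite !Nat.pow_add_r. assert (H1 := pow2_pos b).
    change (2 ^ 1) with 2. revert Hj H1 Hr. generalize (2 ^ b), (2 ^ k). intros B K **.
    assert (2 * (j * B + r) + 1 < B * (K * 2)) by nia. nia.
Qed.

(** * Balanced colorings *)

Lemma averaging n f b : 1 <= n -> sumn n f <= n * b -> exists i, i < n /\ f i <= b.
Proof.
  intros Hn H. apply NNPP. intros N.
  assert (sumn n (fun _ => S b) <= sumn n f).
  { apply sumn_le. intros i Hi. apply Nat.nle_gt. eauto. }
  rewrite sumn_const in H0. nia.
Qed.

(** Bernoulli's inequality (1 - 1/(Q+1))^k >= 1 - k/(Q+1), cleared of denominators. *)
Lemma succ_pow_bernoulli Q k : k <= Q + 1 -> (Q + 1) ^ k * (Q + 1 - k) <= Q ^ k * (Q + 1).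
Proof.
  induction k as [|k IH]; intros Hk; [simpl; lia|].
  specialize (IH ltac:(lia)). cbn [Nat.pow].
  assert ((Q + 1) * (Q + 1 - S k) <= Q * (Q + 1 - k)).
  { replace (Q + 1 - S k) with (Q - k) by lia.
    assert (exists d, Q = k + d) as [d ->] by (exists (Q - k); lia).
    replace (k + d - k) with d by lia. replace (k + d + 1 - k) with (d + 1) by lia. nia. }
  transitivity ((Q + 1) ^ k * (Q * (Q + 1 - k))); [|nia].
  replace ((Q + 1) * (Q + 1) ^ k * (Q + 1 - S k))
    with ((Q + 1) ^ k * ((Q + 1) * (Q + 1 - S k))) by lia.
  now apply Nat.mul_le_mono_l.
Qed.

(** This is (1 + 1/Q)^Q <= 4. Bernoulli's inequality gives a factor at most 2 for exponents up to
    (Q+1)/2, and [Q] is the sum of two such exponents. *)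
Lemma succ_pow_self Q : (Q + 1) ^ Q <= 4 * Q ^ Q.
Proof.
  assert (H : forall k, 2 * k <= Q + 1 -> (Q + 1) ^ k <= 2 * Q ^ k).
  { intros k Hk. assert (B := succ_pow_bernoulli Q k ltac:(lia)).
    assert (Q + 1 <= 2 * (Q + 1 - k)) by lia. nia. }
  assert (E : Q = Q / 2 + (Q - Q / 2)).
  { assert (Q / 2 <= Q) by (apply Nat.Div0.div_le_upper_bound; lia). lia. }
  assert (D := Nat.div_mod_eq Q 2). assert (L := Nat.mod_upper_bound Q 2 ltac:(lia)).
  set (k1 := Q / 2) in *. set (k2 := Q - k1) in *.
  assert (H1 := H k1 ltac:(lia)). assert (H2 := H k2 ltac:(lia)).
  rewrite E at 2 4. rewrite !Nat.pow_add_r. nia.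
Qed.

(* The colors are chosen one point at a time so that the potential
   sum_j (Q/(Q+1))^|S_j| sum_i 2^|S_j of color i|, restricted to the points already colored
   and scaled by (Q+1)^M, never increases. *)
Section Greedy.
Variables (M Q R L : nat) (S : nat -> nat -> bool) (q : nat -> nat).
Hypothesis HQ : 1 <= Q.
Hypothesis HR : R * Q <= 2 ^ L.
Hypothesis Hsize : forall j, j < R -> cnt M (S j) <= q j * Q.

Let ld k h j i := cnt k (fun w => S j w && (h w =? i)).
Let term k h j := Q ^ cnt k (S j) * (Q + 1) ^ (M - cnt k (S j)) * sumn Q (fun i => 2 ^ ld k h j i).

(** If the new point lies in [S j], each choice of color doubles exactly one summand, so over all
    choices the inner sum becomes Q+1 times the old one; exchanging one factor Q+1 for Q leaves
    exactly [Q] times the term. Hence some color does not increase the potential. *)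
Lemma term_step k h j : k < M ->
  sumn Q (fun c => term (k + 1) (upd h k c) j) = Q * term k h j.
Proof.
  intros Hk. unfold term.
  assert (Hc : cnt (k + 1) (S j) = cnt k (S j) + Nat.b2n (S j k)).
  { unfold cnt. rewrite Nat.add_1_r. reflexivity. }
  assert (Hl : forall c i, ld (k + 1) (upd h k c) j i =
    ld k h j i + Nat.b2n (S j k && (c =? i))).
  { intros c i. unfold ld, cnt. rewrite Nat.add_1_r. simpl. rewrite upd_same. f_equal.
    apply sumn_ext. intros w Hw. rewrite upd_other by lia. reflexivity. }
  assert (B := cnt_bound k (S j)).
  destruct (S j k) eqn:E.
  - simpl in Hc. rewrite Hc.
    transitivity (sumn Q (fun c => Q ^ (cnt k (S j) + 1) * (Q + 1) ^ (M - (cnt k (S j) + 1)) *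
      (sumn Q (fun i => 2 ^ ld k h j i) + 2 ^ ld k h j c))).
    + apply sumn_ext. intros c Hcc. f_equal.
      assert (Es : sumn Q (fun i => if c =? i then 2 ^ ld k h j i else 0) = 2 ^ ld k h j c).
      { rewrite (sumn_single Q _ c); auto.
        - now rewrite Nat.eqb_refl.
        - intros i Hi N. rewrite (proj2 (Nat.eqb_neq c i)); auto. }
      rewrite <- Es, <- sumn_add. apply sumn_ext. intros i Hi. rewrite Hl.
      destruct (c =? i); simpl; rewrite ?Nat.add_0_r, ?Nat.add_1_r; simpl; lia.
    + rewrite sumn_mul, sumn_add, sumn_const.
      replace (M - cnt k (S j)) with (M - (cnt k (S j) + 1) + 1) by lia.
      rewrite !Nat.pow_add_r, !Nat.pow_1_r. lia.
  - simpl in Hc. rewrite Hc, Nat.add_0_r.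
    etransitivity; [|apply sumn_const]. apply sumn_ext. intros c Hcc. f_equal. apply sumn_ext.
    intros i Hi. rewrite Hl. simpl. now rewrite Nat.add_0_r.
Qed.

Lemma greedy k : k <= M -> exists h, (forall w, h w < Q) /\
  sumn R (term k h) <= R * (Q * (Q + 1) ^ M).
Proof.
  induction k as [|k IH]; intros Hk.
  - exists (fun _ => 0). split; [lia|]. apply sumn_le_const.
    intros j Hj. unfold term, ld, cnt. simpl. rewrite sumn_const, Nat.sub_0_r. lia.
  - destruct (IH ltac:(lia)) as (h & Hh & Hp).
    destruct (averaging Q (fun c => sumn R (term (k + 1) (upd h k c))) (sumn R (term k h)))
      as (c & Hc & Hle); auto.
    + rewrite sumn_swap, <- sumn_mul. apply sumn_le. intros j Hj. now rewrite term_step.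
    + exists (upd h k c). split.
      * intros w. unfold upd. destruct (w =? k); auto.
      * rewrite <- Nat.add_1_r. lia.
Qed.

(** In the final potential a single summand 2^l satisfies 2^l <= R * Q * ((Q+1)/Q)^c with c <=
    [q j * Q]. Since (1 + 1/Q)^Q <= 4, this is at most 2^L * 4^(q j). *)
Lemma balanced_coloring : exists h, (forall w, h w < Q) /\
  forall j i, j < R -> i < Q -> cnt M (fun w => S j w && (h w =? i)) <= L + 2 * q j.
Proof.
  destruct (greedy M (le_n M)) as (h & Hh & Hp). exists h. split; auto.
  intros j i Hj Hi. change (ld M h j i <= L + 2 * q j).
  set (l := ld M h j i). set (c := cnt M (S j)). specialize (Hsize j Hj). fold c in Hsize.
  assert (H1 : Q ^ c * (Q + 1) ^ (M - c) * 2 ^ l <= R * (Q * (Q + 1) ^ M)).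
  { etransitivity; [|exact Hp]. etransitivity; [|apply (sumn_term R (term M h) j Hj)].
    unfold term. fold c. apply Nat.mul_le_mono_l.
    apply (sumn_term Q (fun i => 2 ^ ld M h j i) i Hi). }
  assert (Hc : c <= M) by apply cnt_bound.
  assert (H2 : Q ^ c * 2 ^ l <= R * Q * (Q + 1) ^ c).
  { assert (EM : (Q + 1) ^ M = (Q + 1) ^ c * (Q + 1) ^ (M - c)).
    { rewrite <- Nat.pow_add_r. f_equal. lia. }
    rewrite EM in H1. clear EM.
    assert (P : 1 <= (Q + 1) ^ (M - c)) by (apply Nat.neq_0_lt_0, Nat.pow_nonzero; lia).
    apply (Nat.mul_le_mono_pos_r _ _ ((Q + 1) ^ (M - c))); lia. }
  (* [d] pads the exponent [c] to a multiple of [Q], where [succ_pow_self] applies. *)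
  set (d := q j * Q - c).
  assert (Ed : q j * Q = c + d) by (unfold d; lia).
  assert (H3 : (Q + 1) ^ c * Q ^ d <= 4 ^ q j * (Q ^ c * Q ^ d)).
  { rewrite <- Nat.pow_add_r, <- Ed.
    transitivity ((Q + 1) ^ (q j * Q)).
    - rewrite Ed, Nat.pow_add_r. apply Nat.mul_le_mono_l, Nat.pow_le_mono_l. lia.
    - rewrite (Nat.mul_comm (q j)), !Nat.pow_mul_r, <- Nat.pow_mul_l.
      apply Nat.pow_le_mono_l, succ_pow_self. }
  assert (P : 1 <= Q ^ c * Q ^ d).
  { rewrite <- Nat.pow_add_r. apply Nat.neq_0_lt_0, Nat.pow_nonzero. lia. }
  assert (H4 : 2 ^ l <= 2 ^ (L + 2 * q j)).
  { rewrite Nat.pow_add_r, Nat.pow_mul_r. change (2 ^ 2) with 4.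
    apply (Nat.mul_le_mono_pos_r _ _ (Q ^ c * Q ^ d)); [lia|].
    transitivity (R * Q * ((Q + 1) ^ c * Q ^ d)).
    - transitivity (Q ^ c * 2 ^ l * Q ^ d); [lia|].
      transitivity (R * Q * (Q + 1) ^ c * Q ^ d); [|lia].
      now apply Nat.mul_le_mono_r.
    - transitivity (2 ^ L * (4 ^ q j * (Q ^ c * Q ^ d))); [|lia].
      now apply Nat.mul_le_mono. }
  apply (Nat.pow_le_mono_r_iff 2); lia.
Qed.
End Greedy.

(** A coloring is one number written in base [Q], so that all colorings of [M] points can be
    searched below [Q ^ M]. *)
Definition color (Q h w : nat) : nat := (h / Q ^ w) mod Q.

Lemma color_lt Q h w : 1 <= Q -> color Q h w < Q.
Proof. intros. apply Nat.mod_upper_bound. lia. Qed.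

Lemma color_encode Q f M : (forall w, f w < Q) ->
  exists h, h < Q ^ M /\ forall w, w < M -> color Q h w = f w.
Proof.
  intros Hf. assert (HQ := Hf 0). induction M as [|M (h & Hh & E)].
  - exists 0. split; [simpl; lia | lia].
  - exists (h + f M * Q ^ M). assert (P : Q ^ M <> 0) by (apply Nat.pow_nonzero; lia).
    split.
    + cbn [Nat.pow]. assert (H := Nat.mul_le_mono_r _ _ (Q ^ M) (Hf M)). lia.
    + intros w Hw. unfold color. destruct (Nat.eq_dec w M) as [->|N].
      * rewrite Nat.div_add by auto. rewrite Nat.div_small by auto. now apply Nat.mod_small.
      * rewrite <- (E w) by lia. unfold color.
        replace (f M * Q ^ M) with ((f M * Q ^ (M - S w) * Q) * Q ^ w).
        -- rewrite Nat.div_add by (apply Nat.pow_nonzero; lia). apply Nat.Div0.mod_add.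
        -- assert (EM : Q ^ M = Q ^ (M - S w) * (Q * Q ^ w)); [|rewrite EM; lia].
           change (Q * Q ^ w) with (Q ^ S w). rewrite <- Nat.pow_add_r. f_equal. lia.
Qed.

(** * The game *)

Section Game.
(** There are [M] points, [Q] colors, [R] tests, an additive slack [L] and a restart threshold [E].
    Test [j] may hold up to [q j * Q] points, [cmp t c y] says that the code [c] is seen by time [t]
    to be compressible given [y], and [yo w] is the condition belonging to point [w]. *)
Variables (M Q R L E : nat).
(* [T t j w]: point [w] has entered test [j] by time [t]. *)
Variable T : nat -> nat -> nat -> bool.
Variable q : nat -> nat.
Variable cmp : nat -> nat -> nat -> bool.
Variable yo : nat -> nat.

Definition load t h j i := cnt M (fun w => T t j w && (color Q h w =? i)).

Definition balanced t h :=
  allb R (fun j => allb Q (fun i => load t h j i <=? L + 2 * q j)).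

Definition coloring t := least (Q ^ M) (balanced t).

(** A coloring starts with loads at most [L + 2 * q j]; the gap of [q j] means that every death is
    paid for by new points of the test. *)
Definition killed t h i := exb R (fun j => L + 3 * q j <? load t h j i).

(** [s * Q + color Q h w] is the code of the string c that stage [s] assigns to the point. *)
Definition bad t s h w := killed t h (color Q h w) || cmp t (s * Q + color Q h w) (yo w).

Definition over t s h := E <=? cnt M (bad t s h).

(* A pair (number of the current stage, its starting time). *)
Definition stage t := nat_rect (fun _ => nat) (cpair 0 0)
  (fun t z => if over t (pi1 z) (coloring (pi2 z)) then cpair (S (pi1 z)) (S t) else z) t.

Lemma stage_start t : pi2 (stage t) <= t.
Proof.
  induction t; simpl.
  - now rewrite pi2_cpair.
  - destruct (over _ _ _); [now rewrite pi2_cpair | lia].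
Qed.

Lemma stage_mono t t' : t <= t' -> pi1 (stage t) <= pi1 (stage t').
Proof.
  induction 1; auto. etransitivity; [exact IHle|]. simpl.
  destruct (over _ _ _); [rewrite pi1_cpair|]; lia.
Qed.

(** The number of a stage determines its starting time and hence its coloring; this is how a decoder
    holding only the number recovers the coloring. *)
Lemma stage_eq t t' : pi1 (stage t) = pi1 (stage t') -> stage t = stage t'.
Proof.
  assert (H : forall t t', t <= t' -> pi1 (stage t) = pi1 (stage t') -> stage t = stage t').
  { clear. induction 1 as [|u Hu IH]; auto. intros Eq.
    assert (H1 := stage_mono t u Hu). simpl in *.
    destruct (over _ _ _); [rewrite pi1_cpair in Eq; lia|]. auto. }
  intros Eq. destruct (Nat.le_ge_cases t t'); [|symmetry]; auto.
Qed.

Lemma stage_last t t' : t <= t' -> pi1 (stage (S t')) = pi1 (stage t) ->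
  cnt M (bad t' (pi1 (stage t)) (coloring (pi2 (stage t)))) < E.
Proof.
  intros L1 Eq. assert (H1 := stage_mono t t' L1).
  assert (H2 := stage_mono t' (S t') ltac:(lia)).
  assert (Es : stage t' = stage t) by (apply stage_eq; lia).
  simpl in Eq. rewrite Es in Eq.
  destruct (over _ _ _) eqn:Ov; [rewrite pi1_cpair in Eq; lia|].
  unfold over in Ov. now apply Nat.leb_gt.
Qed.

Hypothesis HQ : 1 <= Q.
Hypothesis HR : R * Q <= 2 ^ L.
Hypothesis Tmono : forall t t' j w, t <= t' -> T t j w = true -> T t' j w = true.
Hypothesis Tsize : forall t j, j < R -> cnt M (T t j) <= q j * Q.

Lemma coloring_balanced t : balanced t (coloring t) = true.
Proof.
  destruct (balanced_coloring M Q R L (T t) q HQ HR (Tsize t)) as (f & Hf & Hb).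
  destruct (color_encode Q f M Hf) as (h & Hh & Eh).
  apply (least_spec _ _ h Hh). apply allbP. intros j Hj. apply allbP. intros i Hi.
  apply Nat.leb_le. etransitivity; [|exact (Hb j i Hj Hi)].
  apply cnt_mono. intros w Hw. now rewrite Eh.
Qed.

Lemma balanced_load t h j i : balanced t h = true -> j < R -> i < Q ->
  load t h j i <= L + 2 * q j.
Proof.
  intros H Hj Hi. unfold balanced in H. rewrite allbP in H. specialize (H j Hj).
  rewrite allbP in H. now apply Nat.leb_le, H.
Qed.

Lemma load_mono t t' h j i : t <= t' -> load t h j i <= load t' h j i.
Proof.
  intros. apply cnt_mono. intros w _ Hw. apply andb_true_iff in Hw as [H1 H2].
  apply andb_true_iff. eauto.
Qed.

Hypothesis cmono : forall t t' c y, t <= t' -> cmp t c y = true -> cmp t' c y = true.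

Lemma bad_mono t t' s h w : t <= t' -> bad t s h w = true -> bad t' s h w = true.
Proof.
  intros L1 H. unfold bad in *. apply orb_true_iff in H as [H|H];
    apply orb_true_iff; [left|right; eauto].
  apply exbP in H as (j & Hj & H). apply exbP. exists j. split; auto.
  apply Nat.ltb_lt. apply Nat.ltb_lt in H.
  exact (Nat.lt_le_trans _ _ _ H (load_mono t t' h j (color Q h w) L1)).
Qed.

Lemma sum_load t h j : sumn Q (load t h j) = cnt M (T t j).
Proof.
  unfold load, cnt. rewrite sumn_swap. apply sumn_ext. intros w Hw.
  rewrite (sumn_single Q _ (color Q h w)).
  - rewrite Nat.eqb_refl. now rewrite andb_true_r.
  - now apply color_lt.
  - intros i Hi N. rewrite (proj2 (Nat.eqb_neq _ _)), andb_false_r; auto.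
Qed.

(** [dyn] contains all tests that can grow, and [D] bounds their number. [G] bounds the compressible
    codes per condition, [Y] the conditions, [A1] a color class, and [A2] its part with a given
    condition. *)
Variables (dyn : nat -> bool) (D G Y A1 A2 : nat).
Hypothesis qpos : forall j, 1 <= q j.
Hypothesis static : forall t j w, dyn j = false -> T t j w = T 0 j w.
Hypothesis dyn_count : cnt R dyn <= D.
Hypothesis csize : forall t y n, cnt n (fun c => cmp t c y) <= G.
Hypothesis yo_lt : forall w, w < M -> yo w < Y.
Hypothesis class_size : forall t h i, balanced t h = true -> i < Q ->
  cnt M (fun w => color Q h w =? i) <= A1.
Hypothesis cell_size : forall t h i y, balanced t h = true -> i < Q -> y < Y ->
  cnt M (fun w => (yo w =? y) && (color Q h w =? i)) <= A2.

Let kills t h j := cnt Q (fun i => L + 3 * q j <? load t h j i).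

(** Every color overfull in test [j] has gained more than [q j] points since [t0], and the loads of
    all colors add up to the size of the test. *)
Lemma kills_bound t0 t h j : t0 <= t -> balanced t0 h = true -> j < R ->
  q j * kills t h j + cnt M (T t0 j) <= cnt M (T t j).
Proof.
  intros Ht Hb Hj. rewrite <- !(sum_load _ h). unfold kills, cnt.
  rewrite <- sumn_mul, <- sumn_add. apply sumn_le. intros i Hi.
  assert (H1 := balanced_load t0 h j i Hb Hj Hi). assert (H2 := load_mono t0 t h j i Ht).
  destruct (Nat.ltb_spec (L + 3 * q j) (load t h j i)); simpl; lia.
Qed.

Lemma kills_static t0 t h j : balanced t0 h = true -> j < R ->
  dyn j = false -> kills t h j = 0.
Proof.
  intros Hb Hj Hd. apply sumn_zero. intros i Hi.
  assert (H1 := balanced_load t0 h j i Hb Hj Hi).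
  assert (load t h j i = load t0 h j i).
  { apply cnt_ext. intros w _. now rewrite (static t), (static t0). }
  rewrite (proj2 (Nat.ltb_ge _ _)); [reflexivity|lia].
Qed.

(** A union bound: a dead color spoils its whole class, a compressible code only the points of its
    color with that condition. *)
Lemma bad_bound t0 t s h : balanced t0 h = true ->
  cnt M (bad t s h) <= A1 * sumn R (kills t h) +
    A2 * sumn Y (fun y => cnt Q (fun i => cmp t (s * Q + i) y)).
Proof.
  intros Hb.
  transitivity (cnt M (fun w => killed t h (color Q h w)) +
    cnt M (fun w => cmp t (s * Q + color Q h w) (yo w))).
  { unfold cnt. rewrite <- sumn_add. apply sumn_le. intros w Hw. unfold bad.
    destruct (killed _ _ _), (cmp _ _ _); simpl; lia. }
  apply Nat.add_le_mono.
  - transitivity (sumn Q (fun i => Nat.b2n (killed t h i) * A1)).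
    + transitivity (sumn Q (fun i => Nat.b2n (killed t h i) *
        cnt M (fun w => color Q h w =? i))).
      * unfold cnt. rewrite (sumn_ext Q _ (fun i => sumn M (fun w =>
          Nat.b2n (killed t h i) * Nat.b2n (color Q h w =? i))))
          by (intros; now rewrite sumn_mul).
        rewrite sumn_swap. apply sumn_le. intros w Hw.
        rewrite (sumn_single Q _ (color Q h w)).
        -- rewrite Nat.eqb_refl. simpl. lia.
        -- now apply color_lt.
        -- intros i Hi N. rewrite (proj2 (Nat.eqb_neq _ _)) by auto. simpl. lia.
      * apply sumn_le. intros i Hi. apply Nat.mul_le_mono_l. eauto.
    + rewrite (sumn_ext Q _ (fun i => A1 * Nat.b2n (killed t h i))) by (intros; lia).
      rewrite sumn_mul. apply Nat.mul_le_mono_l. unfold kills, cnt.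
      rewrite sumn_swap. apply sumn_le. intros i Hi.
      destruct (killed t h i) eqn:K; cbn [Nat.b2n]; [|lia].
      unfold killed in K. apply exbP in K as (j & Hj & K).
      etransitivity; [|apply (sumn_term R _ j Hj)]. cbv beta. now rewrite K.
  - transitivity (sumn Y (fun y => sumn Q (fun i => Nat.b2n (cmp t (s * Q + i) y) * A2))).
    + transitivity (sumn Y (fun y => sumn Q (fun i => Nat.b2n (cmp t (s * Q + i) y) *
        cnt M (fun w => (yo w =? y) && (color Q h w =? i))))).
      * unfold cnt.
        rewrite (sumn_ext Y _ (fun y => sumn M (fun w => sumn Q (fun i =>
          Nat.b2n (cmp t (s * Q + i) y) *
          Nat.b2n ((yo w =? y) && (color Q h w =? i)))))).
        2:{ intros y Hy. rewrite <- sumn_swap. apply sumn_ext. intros i Hi.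
            now rewrite sumn_mul. }
        rewrite sumn_swap. apply sumn_le. intros w Hw.
        etransitivity; [|apply (sumn_term Y _ (yo w)); auto].
        cbv beta.
        etransitivity; [|apply (sumn_term Q _ (color Q h w)); now apply color_lt].
        cbv beta. rewrite !Nat.eqb_refl. simpl. lia.
      * apply sumn_le. intros y Hy. apply sumn_le. intros i Hi.
        apply Nat.mul_le_mono_l. eauto.
    + rewrite <- sumn_mul. apply sumn_le. intros y Hy. unfold cnt. rewrite <- sumn_mul.
      apply sumn_le. intros; lia.
Qed.

Let spent s t := sumn Y (fun y => cnt (s * Q) (fun c => cmp t c y)).

(** [K j] counts the deaths in test [j] over all finished stages. Charges of different stages never
    overlap: the points entering a test during different stages are distinct, and the codes of stage
    [s] fill the block from [s * Q] to [S s * Q]. *)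
Lemma stage_invariant t : exists K : nat -> nat,
  (forall j, j < R -> q j * K j <= cnt M (T (pi2 (stage t)) j)) /\
  (forall j, j < R -> dyn j = false -> K j = 0) /\
  pi1 (stage t) * E <= A1 * sumn R K + A2 * spent (pi1 (stage t)) (pi2 (stage t)).
Proof.
  induction t as [|t (K & H1 & H2 & H3)].
  - exists (fun _ => 0). simpl. rewrite pi1_cpair. repeat split; intros; lia.
  - assert (Ht := stage_start t). simpl.
    destruct (over t (pi1 (stage t)) (coloring (pi2 (stage t)))) eqn:Ov;
      [|exists K; auto].
    rewrite pi1_cpair, pi2_cpair.
    set (s := pi1 (stage t)) in *. set (t0 := pi2 (stage t)) in *.
    set (h := coloring t0) in *.
    assert (Hb : balanced t0 h = true) by apply coloring_balanced.
    exists (fun j => K j + kills t h j). repeat split.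
    + intros j Hj. specialize (H1 j Hj). assert (H4 := kills_bound t0 t h j Ht Hb Hj).
      assert (cnt M (T t j) <= cnt M (T (S t) j)) by (apply cnt_mono; intros; eauto).
      lia.
    + intros j Hj Hd. rewrite H2, (kills_static t0) by auto. reflexivity.
    + rewrite sumn_add. unfold over in Ov. apply Nat.leb_le in Ov.
      assert (H4 := bad_bound t0 t s h Hb).
      assert (H5 : spent s t0 + sumn Y (fun y => cnt Q (fun i => cmp t (s * Q + i) y))
        <= spent (S s) (S t)).
      { unfold spent. rewrite <- sumn_add. apply sumn_le. intros y Hy.
        replace (S s * Q) with (s * Q + Q) by lia.
        unfold cnt at 3. rewrite sumn_split. apply Nat.add_le_mono;
          apply cnt_mono; intros c _; apply cmono; lia. }
      simpl. apply (Nat.mul_le_mono_l _ _ A2) in H5. lia.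
Qed.

(** From [q j * K j <= q j * Q], each growing test causes at most [Q] deaths in the whole game, and
    a static test causes none. *)
Theorem stage_bound t : pi1 (stage t) * E <= A1 * (D * Q) + A2 * (Y * G).
Proof.
  destruct (stage_invariant t) as (K & H1 & H2 & H3).
  etransitivity; [exact H3|]. apply Nat.add_le_mono; apply Nat.mul_le_mono_l.
  - transitivity (sumn R (fun j => Q * Nat.b2n (dyn j))).
    + apply sumn_le. intros j Hj. destruct (dyn j) eqn:Hd; simpl.
      * specialize (H1 j Hj). assert (H4 := Tsize (pi2 (stage t)) j Hj).
        specialize (qpos j). nia.
      * rewrite H2; auto. lia.
    + rewrite sumn_mul. fold (cnt R dyn). nia.
  - unfold spent. apply sumn_le_const. intros; apply csize.
Qed.
End Game.

(** * The instance of the game attached to a universal program *)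

Lemma sumn_prod X B f : sumn (X * B) f = sumn X (fun x => sumn B (fun y => f (x * B + y))).
Proof.
  induction X as [|X IH]; simpl; auto.
  rewrite Nat.add_comm, sumn_split, IH. reflexivity.
Qed.

Lemma cnt_image n K F : cnt n (fun y => exb K (fun i => F i =? S y)) <= K.
Proof.
  transitivity (sumn n (fun y => cnt K (fun i => F i =? S y))).
  - apply sumn_le. intros y Hy. unfold exb. destruct (Nat.ltb_spec 0 (cnt K (fun i => F i =? S y)));
      simpl; lia.
  - unfold cnt. rewrite sumn_swap.
    transitivity (sumn K (fun _ => 1)); [|rewrite sumn_const; lia].
    apply sumn_le. intros i Hi. apply (cnt_unique n (fun y => F i =? S y)).
    intros a b _ _ Ha Hb. apply Nat.eqb_eq in Ha, Hb. lia.
Qed.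

Lemma cnt_below n K : cnt n (fun i => i <? K) <= K.
Proof.
  assert (H : cnt n (fun i => i <? K) <= Nat.min n K); [|lia].
  induction n; [apply Nat.le_0_l|]. unfold cnt in *. cbn [sumn].
  destruct (Nat.ltb_spec n K); cbn [Nat.b2n]; lia.
Qed.

Section Instance.
Variable P : prog.

(* Points code pairs [(x, y)] of (codes of) strings of lengths at most [m] and [n]. *)
Definition xof n w := w / 2 ^ (n + 1).
Definition yof n w := w mod 2 ^ (n + 1).

Definition related n t f k w :=
  exb (2 ^ (k + 1)) (fun p => ueval P t p (spair (xof n w) f) =? S (yof n w)).

(* Test [k * 2^(m+l+1) + p]: for [k <= l], the pairs [(x, y)] such that [y] has complexity
   at most [k] given [x] and the output of [p]; the last two blocks are the lines
   [x = p] and [y = p]. *)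
Definition test m n l t j w :=
  let k := j / 2 ^ (m + l + 1) in let p := j mod 2 ^ (m + l + 1) in
  if k <=? l then (p <? 2 ^ (l + 1)) && ((1 <=? ueval P t p 0) &&
    related n t (pred (ueval P t p 0)) k w)
  else if k =? l + 1 then xof n w =? p else yof n w =? p.

(** Times the [2 ^ n] colors, this bounds the size of the test: 2^(m+1) values of x with at most
    2^(k+1) programs each, 2^(n+1) points with a given x, 2^(m+1) with a given y. *)
Definition weight m n l j :=
  let k := j / 2 ^ (m + l + 1) in
  if k <=? l then 2 ^ (m - n + k + 2) else if k =? l + 1 then 2 else 2 ^ (m - n + 1).

(** The codes below [2 ^ (n + l)] include all programs shorter than n + l. *)
Definition compressed n l t c y :=
  exb (2 ^ (n + l)) (fun p => ueval P t p y =? S c).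

Definition gM m n := 2 ^ (m + 1) * 2 ^ (n + 1).
Definition gR m l := (l + 3) * 2 ^ (m + l + 1).
(** An upper bound for the binary logarithm of [gR m l * 2 ^ n], with l + 3 crudely replaced by
    2^(l+3). *)
Definition gL m n l := 2 * l + m + n + 4.
(** The fraction 2^-g of all 2^(m+n+2) points; by truncated subtraction the threshold is 1 when [g]
    is larger than m + n + 2. *)
Definition gE m n g := 2 ^ (m + n + 2 - g).

Definition gstage m n l g := stage (gM m n) (2 ^ n) (gR m l) (gL m n l) (gE m n g)
  (test m n l) (weight m n l) (compressed n l) (yof n).
Definition gcoloring m n l := coloring (gM m n) (2 ^ n) (gR m l) (gL m n l)
  (test m n l) (weight m n l).
Definition gbad m n l := bad (gM m n) (2 ^ n) (gR m l) (gL m n l)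
  (test m n l) (weight m n l) (compressed n l) (yof n).

Lemma xof_point n x y : y < 2 ^ (n + 1) -> xof n (x * 2 ^ (n + 1) + y) = x.
Proof.
  intros. unfold xof. rewrite Nat.div_add_l, Nat.div_small by lia. lia.
Qed.

Lemma yof_point n x y : y < 2 ^ (n + 1) -> yof n (x * 2 ^ (n + 1) + y) = y.
Proof.
  intros. unfold yof. rewrite Nat.add_comm, Nat.Div0.mod_add. now apply Nat.mod_small.
Qed.

Lemma related_mono n t t' f k w : t <= t' ->
  related n t f k w = true -> related n t' f k w = true.
Proof.
  intros L H. apply exbP in H as (p & Hp & E). apply Nat.eqb_eq in E.
  apply exbP. exists p. split; auto. apply Nat.eqb_eq. eapply ueval_mono; eauto.
Qed.

Lemma compressed_mono n l t t' c y : t <= t' ->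
  compressed n l t c y = true -> compressed n l t' c y = true.
Proof.
  intros L H. apply exbP in H as (p & Hp & E). apply Nat.eqb_eq in E.
  apply exbP. exists p. split; auto. apply Nat.eqb_eq. eapply ueval_mono; eauto.
Qed.

Lemma test_mono m n l t t' j w : t <= t' ->
  test m n l t j w = true -> test m n l t' j w = true.
Proof.
  intros L. unfold test. destruct (_ <=? l); auto. intros H.
  apply andb_true_iff in H as [H1 H]. apply andb_true_iff in H as [H2 H3].
  rewrite H1. simpl. apply Nat.leb_le in H2.
  destruct (ueval P t (j mod 2 ^ (m + l + 1)) 0) as [|f] eqn:E; [lia|].
  rewrite (ueval_mono P t t' _ _ _ L E). simpl. simpl in H3. eapply related_mono; eauto.
Qed.

Lemma test_size m n l t j : n <= m -> j < gR m l ->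
  cnt (gM m n) (test m n l t j) <= weight m n l j * 2 ^ n.
Proof.
  intros Hnm Hj. unfold cnt, gM. rewrite sumn_prod. unfold test, weight.
  set (k := j / 2 ^ (m + l + 1)). set (p := j mod 2 ^ (m + l + 1)).
  destruct (Nat.leb_spec k l) as [Hk|Hk]; [|destruct (Nat.eqb_spec k (l + 1)) as [E|E]].
  - transitivity (sumn (2 ^ (m + 1)) (fun _ => 2 ^ (k + 1))).
    + apply sumn_le. intros x Hx. set (f := pred (ueval P t p 0)).
      etransitivity; [|apply (cnt_image (2 ^ (n + 1)) (2 ^ (k + 1))
        (fun i => ueval P t i (spair x f)))].
      apply sumn_le. intros y Hy. unfold related. rewrite xof_point, yof_point by auto.
      destruct (p <? 2 ^ (l + 1)), (1 <=? ueval P t p 0); simpl; lia.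
    + rewrite sumn_const, <- !Nat.pow_add_r. apply Nat.eq_le_incl. f_equal. lia.
  - transitivity (sumn (2 ^ (m + 1)) (fun x => 2 ^ (n + 1) * Nat.b2n (x =? p))).
    + apply sumn_le. intros x Hx. apply sumn_le_const. intros y Hy.
      rewrite xof_point by auto. lia.
    + rewrite sumn_mul. fold (cnt (2 ^ (m + 1)) (fun x => x =? p)).
      assert (cnt (2 ^ (m + 1)) (fun x => x =? p) <= 1).
      { apply cnt_unique. intros a b _ _ Ha Hb. apply Nat.eqb_eq in Ha, Hb. congruence. }
      rewrite Nat.pow_add_r. simpl (2 ^ 1). nia.
  - transitivity (sumn (2 ^ (m + 1)) (fun x => 1)).
    + apply sumn_le. intros x Hx.
      apply (cnt_unique (2 ^ (n + 1)) (fun y => yof n (x * 2 ^ (n + 1) + y) =? p)).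
      intros a b La Lb Ha Hb. apply Nat.eqb_eq in Ha, Hb. rewrite yof_point in Ha, Hb by auto.
      congruence.
    + rewrite sumn_const, <- Nat.pow_add_r, Nat.mul_1_r. apply Nat.eq_le_incl. f_equal. lia.
Qed.

Lemma test_index m l k p : p < 2 ^ (m + l + 1) ->
  (k * 2 ^ (m + l + 1) + p) / 2 ^ (m + l + 1) = k /\
  (k * 2 ^ (m + l + 1) + p) mod 2 ^ (m + l + 1) = p.
Proof.
  intros. split.
  - rewrite Nat.div_add_l, Nat.div_small by lia. lia.
  - rewrite Nat.add_comm, Nat.Div0.mod_add. now apply Nat.mod_small.
Qed.

Lemma test_index_lt m l k p : p < 2 ^ (m + l + 1) -> k < l + 3 ->
  k * 2 ^ (m + l + 1) + p < gR m l.
Proof. intros. unfold gR. nia. Qed.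

(** All blocks have the size 2^(m+l+1), wide enough to index every line. Only the first 2^(l+1)
    tests of an enumerable block can grow, and their number, free of the factor 2^m, is what enters
    the bound on the stages. *)
Definition dynamic m l j :=
  (j / 2 ^ (m + l + 1) <=? l) && (j mod 2 ^ (m + l + 1) <? 2 ^ (l + 1)).

Lemma test_static m n l t j w : dynamic m l j = false ->
  test m n l t j w = test m n l 0 j w.
Proof.
  unfold dynamic, test. destruct (_ <=? l); auto. simpl. now intros ->.
Qed.

Lemma dynamic_count m l : cnt (gR m l) (dynamic m l) <= (l + 3) * 2 ^ (l + 1).
Proof.
  unfold gR, cnt. rewrite sumn_prod. apply sumn_le_const. intros k Hk.
  etransitivity; [|apply (cnt_below (2 ^ (m + l + 1)))].
  apply sumn_le. intros p Hp. unfold dynamic.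
  destruct (test_index m l k p Hp) as [-> ->].
  destruct (k <=? l); simpl; lia.
Qed.

Lemma weight_pos m n l j : 1 <= weight m n l j.
Proof.
  unfold weight. repeat match goal with |- context [if ?b then _ else _] => destruct b end;
    try apply pow2_pos; lia.
Qed.

Lemma colors_pos n : 1 <= 2 ^ n.
Proof. apply pow2_pos. Qed.

Lemma load_capacity m n l : gR m l * 2 ^ n <= 2 ^ gL m n l.
Proof.
  unfold gR, gL. assert (H : l + 3 < 2 ^ (l + 3)) by (apply Nat.pow_gt_lin_r; lia).
  replace (2 * l + m + n + 4) with ((l + 3) + (m + l + 1) + n) by lia.
  rewrite !Nat.pow_add_r. rewrite !Nat.pow_add_r in H.
  repeat apply Nat.mul_le_mono_r. lia.
Qed.

(** A line with x fixed is a test of weight 2, whence [gL + 2 * 2]. It serves twice: it bounds the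
    color classes, and it leaves few candidates for b once a and the color are known. *)
Lemma line_load m n l t h x i : n <= m ->
  balanced (gM m n) (2 ^ n) (gR m l) (gL m n l) (test m n l) (weight m n l) t h = true ->
  i < 2 ^ n -> x < 2 ^ (m + 1) ->
  cnt (gM m n) (fun w => (xof n w =? x) && (color (2 ^ n) h w =? i)) <= gL m n l + 4.
Proof.
  intros Hnm Hb Hi Hx.
  assert (Hp : x < 2 ^ (m + l + 1)).
  { assert (2 ^ (m + 1) <= 2 ^ (m + l + 1)) by (apply Nat.pow_le_mono_r; lia). lia. }
  destruct (test_index m l (l + 1) x Hp) as [E1 E2].
  assert (H := balanced_load _ _ _ _ _ _ t h ((l + 1) * 2 ^ (m + l + 1) + x) i Hb
    (test_index_lt m l (l + 1) x Hp ltac:(lia)) Hi).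
  unfold load, weight in H. rewrite E1, (proj2 (Nat.leb_gt (l + 1) l)), Nat.eqb_refl in H
    by lia.
  etransitivity; [|exact H]. apply cnt_mono. intros w Hw. unfold test.
  now rewrite E1, E2, (proj2 (Nat.leb_gt (l + 1) l)), Nat.eqb_refl by lia.
Qed.

Lemma column_load m n l t h y i : n <= m ->
  balanced (gM m n) (2 ^ n) (gR m l) (gL m n l) (test m n l) (weight m n l) t h = true ->
  i < 2 ^ n -> y < 2 ^ (n + 1) ->
  cnt (gM m n) (fun w => (yof n w =? y) && (color (2 ^ n) h w =? i))
    <= gL m n l + 2 ^ (m - n + 2).
Proof.
  intros Hnm Hb Hi Hy.
  assert (Hp : y < 2 ^ (m + l + 1)).
  { assert (2 ^ (n + 1) <= 2 ^ (m + l + 1)) by (apply Nat.pow_le_mono_r; lia). lia. }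
  destruct (test_index m l (l + 2) y Hp) as [E1 E2].
  assert (H := balanced_load _ _ _ _ _ _ t h ((l + 2) * 2 ^ (m + l + 1) + y) i Hb
    (test_index_lt m l (l + 2) y Hp ltac:(lia)) Hi).
  unfold load, weight in H. rewrite E1, (proj2 (Nat.leb_gt (l + 2) l)),
    (proj2 (Nat.eqb_neq (l + 2) (l + 1))) in H by lia.
  replace (m - n + 2) with (S (m - n + 1)) by lia. rewrite Nat.pow_succ_r'.
  etransitivity; [|exact H]. apply cnt_mono. intros w Hw. unfold test.
  now rewrite E1, E2, (proj2 (Nat.leb_gt (l + 2) l)),
    (proj2 (Nat.eqb_neq (l + 2) (l + 1))) by lia.
Qed.

Lemma gcoloring_balanced m n l t : n <= m ->
  balanced (gM m n) (2 ^ n) (gR m l) (gL m n l) (test m n l) (weight m n l)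
    t (gcoloring m n l t) = true.
Proof.
  intros. apply coloring_balanced.
  - apply colors_pos.
  - apply load_capacity.
  - intros; now apply test_size.
Qed.

Lemma gstage_mono m n l g t t' : t <= t' ->
  pi1 (gstage m n l g t) <= pi1 (gstage m n l g t').
Proof. apply stage_mono. Qed.

Lemma gstage_eq m n l g t t' :
  pi1 (gstage m n l g t) = pi1 (gstage m n l g t') -> gstage m n l g t = gstage m n l g t'.
Proof. apply stage_eq. Qed.

Lemma gstage_last m n l g t t' :
  t <= t' -> pi1 (gstage m n l g (S t')) = pi1 (gstage m n l g t) ->
  cnt (gM m n) (gbad m n l t' (pi1 (gstage m n l g t))
    (gcoloring m n l (pi2 (gstage m n l g t)))) < gE m n g.
Proof. apply stage_last. Qed.

Lemma gbad_mono m n l t t' s h w : t <= t' ->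
  gbad m n l t s h w = true -> gbad m n l t' s h w = true.
Proof.
  intros L. apply bad_mono; auto.
  - intros; eapply test_mono; eauto.
  - intros; eapply compressed_mono; eauto.
Qed.

Lemma gstage_bound m n l g t : n <= m ->
  pi1 (gstage m n l g t) * gE m n g <=
    2 ^ (m + 1) * (gL m n l + 4) * ((l + 3) * 2 ^ (l + 1) * 2 ^ n) +
    (gL m n l + 2 ^ (m - n + 2)) * (2 ^ (n + 1) * 2 ^ (n + l)).
Proof.
  intros Hnm. apply stage_bound with (dyn := dynamic m l); auto.
  - apply colors_pos.
  - apply load_capacity.
  - intros; eapply test_mono; eauto.
  - intros; now apply test_size.
  - intros; eapply compressed_mono; eauto.
  - intros; apply weight_pos.
  - intros; now apply test_static.
  - apply dynamic_count.
  - intros. apply cnt_image.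
  - intros w Hw. apply Nat.mod_upper_bound. apply Nat.pow_nonzero. lia.
  (* A color class is cut into 2^(m+1) lines with x fixed, each carrying few of its points. *)
  - intros t0 h i Hb Hi.
    transitivity (sumn (2 ^ (m + 1)) (fun x => cnt (gM m n)
      (fun w => (xof n w =? x) && (color (2 ^ n) h w =? i)))).
    + unfold cnt. rewrite sumn_swap. apply sumn_le. intros w Hw.
      etransitivity; [|apply (sumn_term _ _ (xof n w))].
      * cbv beta. rewrite Nat.eqb_refl. simpl. lia.
      * apply Nat.Div0.div_lt_upper_bound. unfold gM in Hw. lia.
    + apply sumn_le_const. intros x Hx. now apply line_load with t0.
  - intros t0 h i y Hb Hi Hy. now apply column_load with t0.
Qed.

(** Each of the two charges is at most 2^(m+n+l+2e+6), and division by the threshold adds [g] to the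
    exponent. Factors polynomial in m and l turn into multiples of [e]. *)
Lemma gstage_lt m n l g e t : n + 4 <= m -> m < 2 ^ e -> l < 2 ^ e -> 3 <= e ->
  pi1 (gstage m n l g t) < 2 ^ (l + g + 4 * e).
Proof.
  intros Hnm Hm Hl He. assert (H := gstage_bound m n l g t ltac:(lia)).
  set (s := pi1 _) in *.
  assert (HL : gL m n l + 4 <= 2 ^ (e + 3)).
  { unfold gL. rewrite Nat.pow_add_r. change (2 ^ 3) with 8. lia. }
  assert (Hl3 : l + 3 <= 2 ^ (e + 1)).
  { rewrite Nat.pow_add_r. change (2 ^ 1) with 2. lia. }
  assert (H1 : 2 ^ (m + 1) * (gL m n l + 4) * ((l + 3) * 2 ^ (l + 1) * 2 ^ n)
    <= 2 ^ (m + n + l + 2 * e + 6)).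
  { transitivity (2 ^ (m + 1) * 2 ^ (e + 3) * (2 ^ (e + 1) * 2 ^ (l + 1) * 2 ^ n)).
    - apply Nat.mul_le_mono; [now apply Nat.mul_le_mono_l|].
      now repeat apply Nat.mul_le_mono_r.
    - rewrite <- !Nat.pow_add_r. apply Nat.pow_le_mono_r; lia. }
  assert (H2 : (gL m n l + 2 ^ (m - n + 2)) * (2 ^ (n + 1) * 2 ^ (n + l))
    <= 2 ^ (m + n + l + 2 * e + 6)).
  { transitivity (2 ^ (e + 3 + (m - n + 2)) * (2 ^ (n + 1) * 2 ^ (n + l))).
    - apply Nat.mul_le_mono_r. rewrite (Nat.pow_add_r 2 (e + 3)).
      assert (H0 : 2 <= 2 ^ (m - n + 2)).
      { change 2 with (2 ^ 1) at 1. apply Nat.pow_le_mono_r; lia. }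
      assert (H2 : 2 <= 2 ^ (e + 3)).
      { change 2 with (2 ^ 1) at 1. apply Nat.pow_le_mono_r; lia. }
      assert (HL' : gL m n l <= 2 ^ (e + 3)) by lia.
      revert H0 H2 HL'. generalize (2 ^ (m - n + 2)), (2 ^ (e + 3)), (gL m n l).
      clear. intros. nia.
    - rewrite <- !Nat.pow_add_r. apply Nat.pow_le_mono_r; lia. }
  assert (H3 : s * 2 ^ (m + n + 2) <= 2 ^ (m + n + l + 2 * e + 7 + g)).
  { transitivity (s * gE m n g * 2 ^ g).
    - unfold gE. rewrite <- Nat.mul_assoc, <- Nat.pow_add_r. apply Nat.mul_le_mono_l.
      apply Nat.pow_le_mono_r; lia.
    - rewrite (Nat.pow_add_r 2 _ g). apply Nat.mul_le_mono_r.
      replace (m + n + l + 2 * e + 7) with (S (m + n + l + 2 * e + 6)) by lia.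
      rewrite Nat.pow_succ_r'. lia. }
  apply Nat.le_lt_trans with (2 ^ (l + 2 * e + 5 + g)).
  - apply (Nat.mul_le_mono_pos_r _ _ (2 ^ (m + n + 2))); [apply pow2_pos|].
    rewrite <- Nat.pow_add_r. etransitivity; [exact H3|].
    apply Nat.pow_le_mono_r; lia.
  - apply Nat.pow_lt_mono_r; lia.
Qed.

(** * Primitive recursiveness of the game *)

Lemma pr_color O q h w : pr O q -> pr O h -> pr O w ->
  pr O (fun x => color (q x) (h x) (w x)).
Proof. intros. unfold color. prs. Qed.

Lemma prb_related O n t f k w : pr O n -> pr O t -> pr O f -> pr O k -> pr O w ->
  prb O (fun x => related (n x) (t x) (f x) (k x) (w x)).
Proof.
  intros. unfold related, xof, yof. apply prb_exb; [prs|]. apply prb_eqb; [|prs].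
  apply pr_ueval; prs.
Qed.

Lemma prb_compressed O n l t c y : pr O n -> pr O l -> pr O t -> pr O c -> pr O y ->
  prb O (fun x => compressed (n x) (l x) (t x) (c x) (y x)).
Proof.
  intros. unfold compressed. apply prb_exb; [prs|]. apply prb_eqb; [|prs].
  apply pr_ueval; prs.
Qed.

Lemma pr_weight O m n l j : pr O m -> pr O n -> pr O l -> pr O j ->
  pr O (fun x => weight (m x) (n x) (l x) (j x)).
Proof. intros. unfold weight. prs. Qed.

Lemma prb_test O m n l t j w : pr O m -> pr O n -> pr O l -> pr O t -> pr O j -> pr O w ->
  prb O (fun x => test (m x) (n x) (l x) (t x) (j x) (w x)).
Proof.
  intros. unfold test. cbv zeta. apply prb_if; [prs| |].
  - apply prb_andb; [prs|]. apply prb_andb.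
    + apply prb_leb; [prs|]. apply pr_ueval; prs.
    + apply prb_related; try prs. apply pr_pred, pr_ueval; prs.
  - unfold xof, yof. prs.
Qed.

Lemma pr_load O m n l t h j i : pr O m -> pr O n -> pr O l -> pr O t -> pr O h ->
  pr O j -> pr O i ->
  pr O (fun x => load (gM (m x) (n x)) (2 ^ n x) (test (m x) (n x) (l x))
    (t x) (h x) (j x) (i x)).
Proof.
  intros. unfold load, gM. apply pr_cnt; [prs|]. apply prb_andb.
  - apply prb_test; prs.
  - apply prb_eqb; [apply pr_color; prs | prs].
Qed.

Lemma pr_gcoloring O m n l t : pr O m -> pr O n -> pr O l -> pr O t ->
  pr O (fun x => gcoloring (m x) (n x) (l x) (t x)).
Proof.
  intros. unfold gcoloring, coloring, balanced. apply pr_least; [unfold gM; prs|].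
  apply prb_allb; [unfold gR; prs|]. apply prb_allb; [prs|]. apply prb_leb.
  - apply pr_load; prs.
  - unfold gL. apply pr_add; [prs|]. apply pr_mul; [prs|]. apply pr_weight; prs.
Qed.

Lemma prb_gbad O m n l t s h w : pr O m -> pr O n -> pr O l -> pr O t -> pr O s ->
  pr O h -> pr O w ->
  prb O (fun x => gbad (m x) (n x) (l x) (t x) (s x) (h x) (w x)).
Proof.
  intros. unfold gbad, bad. apply prb_orb.
  - unfold killed. apply prb_exb; [unfold gR; prs|]. apply prb_ltb.
    + unfold gL. apply pr_add; [prs|]. apply pr_mul; [prs|]. apply pr_weight; prs.
    + apply pr_load; try prs. apply pr_color; prs.
  - apply prb_compressed; try prs.
    + apply pr_add; [prs|]. apply pr_color; prs.
    + unfold yof. prs.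
Qed.

Lemma pr_gstage O m n l g t : pr O m -> pr O n -> pr O l -> pr O g -> pr O t ->
  pr O (fun x => gstage (m x) (n x) (l x) (g x) (t x)).
Proof.
  intros. unfold gstage, stage. apply pr_rec; [prs|prs|]. apply pr_if; [|prs|prs].
  unfold over. apply prb_leb; [unfold gE; prs|]. apply pr_cnt; [unfold gM; prs|].
  apply prb_gbad; try prs. apply pr_gcoloring; prs.
Qed.
End Instance.

(** * Descriptions obtained from a stage of the game *)

Lemma optimal_total O U : optimal O U ->
  exists c, forall x y, exists q, U q y x /\ length q <= length x + c.
Proof.
  intros HU. destruct (optimal_search O U (fun _ _ => 0) (fun z _ => npfst z) HU)
    as [c Hc]; [prs | prs |].
  exists c. intros x y. apply (Hc x y x 0); auto; [lia|]. apply npfst_npair.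
Qed.

Lemma optimal_program U : optimal no_oracle U -> exists P, forall p y x,
  U p y x <-> exists t, ueval P t (str_code p) (str_code y) = S (str_code x).
Proof.
  intros [[P HP] _]. exists P. intros. now rewrite HP, ueval_computes.
Qed.

Lemma KSc_le_KS U : optimal no_oracle U ->
  exists c, forall x y, KSc U x y <= KS U x + c.
Proof.
  intros HU. destruct (optimal_program U HU) as [P HP].
  destruct (optimal_total _ U HU) as [c0 Hc0].
  destruct (optimal_search no_oracle U (fun z t => 1 - ueval P t (npfst z) 0)
    (fun z t => pred (ueval P t (npfst z) 0)) HU) as [c Hc].
  { apply pr_sub; [prs|]. apply pr_ueval; prs. }
  { apply pr_pred, pr_ueval; prs. }
  exists c. intros x y. destruct (Hc0 x nil) as (q & Hq & _).
  destruct (KSc_spec U q nil x Hq) as [(p & Hp & Ep) _]. fold (KS U x) in Ep.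
  apply HP in Hp as [t0 Ht0]. simpl str_code in Ht0.
  destruct (dec_inh_nat_subset_has_unique_least_element
    (fun t => ueval P t (str_code p) 0 <> 0)) as (t & (Ht & Hmin) & _).
  { intros; apply classic. } { exists t0. congruence. }
  destruct (ueval P t (str_code p) 0) as [|x'] eqn:Et; [lia|].
  assert (x' = str_code x) as -> by (eapply ueval_fun; eauto).
  destruct (Hc p y x t) as (q' & Hq' & L).
  - rewrite npfst_npair, Et. lia.
  - intros t' L. rewrite npfst_npair. intros E.
    assert (ueval P t' (str_code p) 0 <> 0) by lia. apply Hmin in H. lia.
  - now rewrite npfst_npair, Et.
  - assert (H := proj2 (KSc_spec U q' y x Hq') q' Hq'). lia.
Qed.

(** Finitely many enumerated elements are all present at one common time, so a bound valid at each
    time bounds their number. *)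
Lemma enumeration_size M K (F : nat -> nat -> bool) ks :
  (forall t t' i, t <= t' -> F t i = true -> F t' i = true) ->
  (forall t, cnt M (F t) <= K) -> NoDup ks ->
  (forall i, In i ks -> i < M /\ exists t, F t i = true) -> length ks <= K.
Proof.
  intros Hm Hc Hd Hi.
  assert (exists t, forall i, In i ks -> F t i = true) as [t Ht].
  { clear Hd Hc. induction ks as [|j ks IH]; [exists 0; intros i []|].
    destruct IH as [t Ht]; [intros; apply Hi; now right|].
    destruct (Hi j (or_introl eq_refl)) as (_ & t' & Ht').
    exists (Nat.max t t'). intros i [->|H]; [apply (Hm t')|apply (Hm t)]; auto; lia. }
  etransitivity; [|apply (Hc t)]. apply NoDup_cnt; auto.
  intros i H. destruct (Hi i H). auto.
Qed.

Lemma monotone_bounded_stabilizes (f : nat -> nat) K :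
  (forall t t', t <= t' -> f t <= f t') -> (forall t, f t <= K) ->
  exists t0, forall t, t0 <= t -> f t = f t0.
Proof.
  intros Hm Hb.
  assert (H : forall d t0, K - f t0 <= d -> exists t0, forall t, t0 <= t -> f t = f t0).
  { induction d as [|d IH]; intros t0 Hd.
    - exists t0. intros t L. specialize (Hm t0 t L). specialize (Hb t). lia.
    - destruct (classic (exists t, t0 <= t /\ f t <> f t0)) as [(t & L & N)|N].
      + apply (IH t). specialize (Hm t0 t L). specialize (Hb t). lia.
      + exists t0. intros t L. apply NNPP. eauto. }
  apply (H (K - f 0) 0); auto.
Qed.

(** What a decoder needs in order to rerun the game; it is shipped as the parameter [r] of
    [enumeration_bound]. *)
Definition params m n l g := cpair m (cpair n (cpair l g)).

Lemma cpair_lt x y u : x < 2 ^ u -> y < 2 ^ u -> cpair x y < 2 ^ (2 * u + 2).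
Proof.
  intros Hx Hy. assert (E := Cantor.to_nat_spec x y). fold (cpair x y) in E.
  replace (2 * u + 2) with (u + u + 1 + 1) by lia. rewrite !Nat.pow_add_r.
  change (2 ^ 1) with 2. revert Hx Hy E. generalize (2 ^ u), (cpair x y). intros. nia.
Qed.

Lemma params_lt m n l g u : m < 2 ^ u -> n < 2 ^ u -> l < 2 ^ u -> g < 2 ^ u ->
  params m n l g < 2 ^ (8 * u + 14).
Proof.
  intros Hm Hn Hl Hg. unfold params.
  assert (W : forall x v, x < 2 ^ u -> u <= v -> x < 2 ^ v).
  { intros x v H L. assert (2 ^ u <= 2 ^ v) by (apply Nat.pow_le_mono_r; lia). lia. }
  replace (8 * u + 14) with (2 * (2 * (2 * u + 2) + 2) + 2) by lia.
  do 2 (apply cpair_lt; [apply W; auto; lia|]). now apply cpair_lt.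
Qed.

Definition point n (a b : list bool) := str_code a * 2 ^ (n + 1) + str_code b.

Lemma point_lt m n a b : length a = m -> length b = n -> point n a b < gM m n.
Proof.
  intros <- <-. assert (Ha := str_code_lt a (length a) (le_n _)).
  assert (Hb := str_code_lt b (length b) (le_n _)). unfold point, gM.
  rewrite !Nat.add_1_r. nia.
Qed.

Lemma xof_ab n a b : length b = n -> xof n (point n a b) = str_code a.
Proof.
  intros <-. apply xof_point. rewrite Nat.add_1_r. apply str_code_lt; lia.
Qed.

Lemma yof_ab n a b : length b = n -> yof n (point n a b) = str_code b.
Proof.
  intros <-. apply yof_point. rewrite Nat.add_1_r. apply str_code_lt; lia.
Qed.

Section Descriptions.
Variable P : prog.

(** Serves (iii). The string c names a stage and a color; once the stage is reached, the candidates
    for b are the points of that color on the line of a, few by [line_load]. *)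
Lemma second_given_first O U : optimal O U -> exists C, forall m n l g a b c t k u,
  n <= m -> length a = m -> length b = n ->
  pi1 (gstage P m n l g t) = str_code c / 2 ^ n ->
  color (2 ^ n) (gcoloring P m n l (pi2 (gstage P m n l g t))) (point n a b)
    = str_code c mod 2 ^ n ->
  params m n l g < 2 ^ u -> gL m n l + 4 <= 2 ^ k ->
  exists q, U q (str_pair a c) b /\ length q <= k + 2 * u + C.
Proof.
  intros HU.
  set (W := fun z w =>
    let c := ssnd (pi1 z) in
    let m := pi1 (pi2 z) in let n := pi1 (pi2 (pi2 z)) in
    let l := pi1 (pi2 (pi2 (pi2 z))) in let g := pi2 (pi2 (pi2 (pi2 z))) in
    let st := gstage P m n l g (pi1 w) in
    (pi1 st =? c / 2 ^ n) && (pi2 w <? 2 ^ (n + 1)) &&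
    (color (2 ^ n) (gcoloring P m n l (pi2 st)) (sfst (pi1 z) * 2 ^ (n + 1) + pi2 w)
      =? c mod 2 ^ n)).
  destruct (enumeration_bound O U W (fun _ y => y) HU) as [C HC].
  { unfold W; cbv zeta. apply prb_andb; [apply prb_andb; [apply prb_eqb|]|apply prb_eqb];
      try prs.
    - apply pr_pi1, pr_gstage; prs.
    - apply pr_color; try prs. apply pr_gcoloring; try prs. apply pr_pi2, pr_gstage; prs. }
  { prs. }
  exists C. intros m n l g a b c t k u Hnm Ha Hb Hs Hcol Hu Hk.
  assert (La : str_code a < 2 ^ (m + 1)) by (rewrite Nat.add_1_r; apply str_code_lt; lia).
  assert (Lb : str_code b < 2 ^ (n + 1)) by (rewrite Nat.add_1_r; apply str_code_lt; lia).
  set (z := cpair (str_code (str_pair a c)) (params m n l g)).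
  assert (EW : forall w, W z w =
    (pi1 (gstage P m n l g (pi1 w)) =? str_code c / 2 ^ n) && (pi2 w <? 2 ^ (n + 1)) &&
    (color (2 ^ n) (gcoloring P m n l (pi2 (gstage P m n l g (pi1 w))))
      (str_code a * 2 ^ (n + 1) + pi2 w) =? str_code c mod 2 ^ n)).
  { intros w. unfold W, z, params. cbv zeta. rewrite <- spair_code.
    rewrite ?pi2_cpair, ?pi1_cpair, ?pi2_cpair, ?pi1_cpair, ?pi2_cpair, ?pi1_cpair,
      ?pi2_cpair, ssnd_spair, sfst_spair. reflexivity. }
  apply (HC (str_pair a c) b (params m n l g) u k (cpair t (str_code b))); auto.
  - intros ks Hd Hi. etransitivity; [|exact Hk].
    assert (Hmap : NoDup (map (fun y => str_code a * 2 ^ (n + 1) + y) ks)).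
    { apply NoDup_map_NoDup_ForallPairs; auto. intros x y _ _ E. lia. }
    rewrite <- (length_map (fun y => str_code a * 2 ^ (n + 1) + y)).
    etransitivity; [|apply (line_load P m n l _
      (gcoloring P m n l (pi2 (gstage P m n l g t))) (str_code a) (str_code c mod 2 ^ n) Hnm
      (gcoloring_balanced P m n l (pi2 (gstage P m n l g t)) Hnm))]; auto.
    2:{ apply Nat.mod_upper_bound, Nat.pow_nonzero; lia. }
    apply NoDup_cnt; auto. intros i Hin. apply in_map_iff in Hin as (y & <- & Hy).
    destruct (Hi y Hy) as (w & Hw & <-). fold z in Hw. rewrite EW in Hw.
    apply andb_true_iff in Hw as [Hw H3]. apply andb_true_iff in Hw as [H1 H2].
    apply Nat.eqb_eq in H1. apply Nat.ltb_lt in H2.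
    rewrite (gstage_eq P m n l g (pi1 w) t) in H3 by congruence.
    split.
    + unfold gM. assert (Hm := Nat.mul_le_mono_r _ _ (2 ^ (n + 1)) La). lia.
    + rewrite xof_point by auto. rewrite Nat.eqb_refl. exact H3.
  - fold z. rewrite EW, pi1_cpair, pi2_cpair, Hs, Nat.eqb_refl.
    unfold point in Hcol. rewrite Hcol, Nat.eqb_refl.
    now rewrite (proj2 (Nat.ltb_lt _ _) Lb).
  - apply pi2_cpair.
Qed.

(** Serves (iv). Here a is unknown, so whole points are enumerated and b is read off as their second
    coordinate; the load of the color, bounded at all times, limits their number. *)
Lemma second_given_helper O U : optimal O U -> exists C, forall m n l g a b c f t t1 k K u,
  length a = m -> length b = n ->
  pi1 (gstage P m n l g t) = str_code c / 2 ^ n ->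
  color (2 ^ n) (gcoloring P m n l (pi2 (gstage P m n l g t))) (point n a b)
    = str_code c mod 2 ^ n ->
  related P n t1 (str_code f) k (point n a b) = true ->
  (forall t', cnt (gM m n) (fun w => related P n t' (str_code f) k w &&
     (color (2 ^ n) (gcoloring P m n l (pi2 (gstage P m n l g t))) w
       =? str_code c mod 2 ^ n)) <= 2 ^ K) ->
  cpair k (params m n l g) < 2 ^ u ->
  exists q, U q (str_pair c f) b /\ length q <= K + 2 * u + C.
Proof.
  intros HU.
  set (W := fun z w =>
    let c := sfst (pi1 z) in let k := pi1 (pi2 z) in
    let m := pi1 (pi2 (pi2 z)) in let n := pi1 (pi2 (pi2 (pi2 z))) in
    let l := pi1 (pi2 (pi2 (pi2 (pi2 z)))) in let g := pi2 (pi2 (pi2 (pi2 (pi2 z)))) in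
    let st := gstage P m n l g (pi1 (pi1 w)) in
    (pi1 st =? c / 2 ^ n) && (pi2 w <? gM m n) &&
    (related P n (pi2 (pi1 w)) (ssnd (pi1 z)) k (pi2 w) &&
    (color (2 ^ n) (gcoloring P m n l (pi2 st)) (pi2 w) =? c mod 2 ^ n))).
  destruct (enumeration_bound O U W (fun z w => yof (pi1 (pi2 (pi2 (pi2 z)))) w) HU)
    as [C HC].
  { unfold W; cbv zeta. apply prb_andb; [apply prb_andb; [apply prb_eqb|]|
      apply prb_andb; [|apply prb_eqb]]; try prs.
    - apply pr_pi1, pr_gstage; prs.
    - unfold gM. prs.
    - apply prb_related; prs.
    - apply pr_color; try prs. apply pr_gcoloring; try prs. apply pr_pi2, pr_gstage; prs. }
  { unfold yof. prs. }
  exists C. intros m n l g a b c f t t1 k K u Ha Hb Hs Hcol Hrel HK Hu.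
  set (z := cpair (str_code (str_pair c f)) (cpair k (params m n l g))).
  assert (EW : forall w, W z w =
    (pi1 (gstage P m n l g (pi1 (pi1 w))) =? str_code c / 2 ^ n) && (pi2 w <? gM m n) &&
    (related P n (pi2 (pi1 w)) (str_code f) k (pi2 w) &&
    (color (2 ^ n) (gcoloring P m n l (pi2 (gstage P m n l g (pi1 (pi1 w))))) (pi2 w)
      =? str_code c mod 2 ^ n))).
  { intros w. unfold W, z, params. cbv zeta. rewrite <- spair_code.
    rewrite ?pi2_cpair, ?pi1_cpair, ?pi2_cpair, ?pi1_cpair, ?pi2_cpair, ?pi1_cpair,
      ?pi2_cpair, ssnd_spair, sfst_spair. reflexivity. }
  apply (HC (str_pair c f) b (cpair k (params m n l g)) u K
    (cpair (cpair t t1) (point n a b))); auto.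
  - intros ks Hd Hi. apply (enumeration_size (gM m n) _ (fun t' w =>
      related P n t' (str_code f) k w &&
      (color (2 ^ n) (gcoloring P m n l (pi2 (gstage P m n l g t))) w
       =? str_code c mod 2 ^ n))); auto.
    + intros t' t'' i L H. apply andb_true_iff in H as [H1 H2]. apply andb_true_iff.
      split; auto. eapply related_mono; eauto.
    + intros i Hin. destruct (Hi i Hin) as (w & Hw & <-). fold z in Hw. rewrite EW in Hw.
      apply andb_true_iff in Hw as [Hw H3]. apply andb_true_iff in Hw as [H1 H2].
      apply Nat.eqb_eq in H1. apply Nat.ltb_lt in H2. split; auto.
      exists (pi2 (pi1 w)).
      rewrite (gstage_eq P m n l g (pi1 (pi1 w)) t) in H3 by congruence.
      exact H3.
  - fold z. rewrite EW, !pi1_cpair, !pi2_cpair, Hs, Nat.eqb_refl, Hrel, Hcol, Nat.eqb_refl.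
    now rewrite (proj2 (Nat.ltb_lt _ _) (point_lt m n a b Ha Hb)).
  - unfold z, params. rewrite !pi2_cpair, pi1_cpair. now apply yof_ab.
Qed.

(** In the last stage the bad points never reach the threshold [gE], so one of them is given by its
    rank in m + n + 2 - g bits. Asking whether a larger stage number ever occurs lets the decoder
    discard all earlier stages. *)
Lemma bad_pair_description V : optimal halting_set V -> exists C, forall m n l g a b t u,
  length a = m -> length b = n ->
  (forall t', t <= t' -> pi1 (gstage P m n l g t') = pi1 (gstage P m n l g t)) ->
  gbad P m n l t (pi1 (gstage P m n l g t))
    (gcoloring P m n l (pi2 (gstage P m n l g t))) (point n a b) = true ->
  params m n l g < 2 ^ u ->
  exists q, V q nil (str_pair a b) /\ length q <= (m + n + 2 - g) + 2 * u + C.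
Proof.
  intros HV.
  (* The oracle recognizes the last stage. *)
  destruct (halting_decides (fun x t =>
    let m := pi1 (pi1 x) in let n := pi1 (pi2 (pi1 x)) in
    let l := pi1 (pi2 (pi2 (pi1 x))) in let g := pi2 (pi2 (pi2 (pi1 x))) in
    Nat.b2n (pi1 (gstage P m n l g t) <=? pi2 x))) as (o & Po & Ho).
  { cbv zeta. apply prb_leb; [|prs]. apply pr_pi1, pr_gstage; prs. }
  set (W := fun z w =>
    let m := pi1 (pi2 z) in let n := pi1 (pi2 (pi2 z)) in
    let l := pi1 (pi2 (pi2 (pi2 z))) in let g := pi2 (pi2 (pi2 (pi2 z))) in
    let st := gstage P m n l g (pi1 w) in
    negb (o (cpair (pi2 z) (pi1 st))) && (pi2 w <? gM m n) &&
    gbad P m n l (pi1 w) (pi1 st) (gcoloring P m n l (pi2 st)) (pi2 w)).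
  destruct (enumeration_bound halting_set V W (fun z w =>
    spair (xof (pi1 (pi2 (pi2 z))) w) (yof (pi1 (pi2 (pi2 z))) w)) HV) as [C HC].
  { unfold W; cbv zeta. apply prb_andb; [apply prb_andb|].
    - apply prb_negb.
      apply (pr_comp halting_set (fun x => Nat.b2n (o x)) (fun z => cpair _ _) Po).
      apply pr_cpair; [prs|]. apply pr_pi1, pr_gstage; prs.
    - unfold gM. prs.
    - apply prb_gbad; try prs.
      + apply pr_pi1, pr_gstage; prs.
      + apply pr_gcoloring; try prs. apply pr_pi2, pr_gstage; prs. }
  { unfold xof, yof. prs. }
  exists C. intros m n l g a b t u Ha Hb Hlast Hbad Hu.
  set (z := cpair (str_code nil) (params m n l g)).
  set (st := fun t => gstage P m n l g t) in *.
  assert (Ho' : forall s, o (cpair (params m n l g) s) = true <-> exists t', s < pi1 (st t')).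
  { intros s. rewrite Ho. unfold params, st.
    split; intros [t' Ht']; exists t'; revert Ht'; cbv zeta;
      rewrite ?pi1_cpair, ?pi2_cpair, ?pi1_cpair, ?pi2_cpair, ?pi1_cpair, ?pi2_cpair;
      rewrite ?pi1_cpair, ?pi2_cpair;
      destruct (Nat.leb_spec (pi1 (gstage P m n l g t')) s); simpl; lia. }
  assert (Hmax : forall t', pi1 (st t') <= pi1 (st t)).
  { intros t'. rewrite <- (Hlast (Nat.max t t')) by lia. apply gstage_mono. lia. }
  assert (EW : forall w, W z w =
    negb (o (cpair (params m n l g) (pi1 (st (pi1 w))))) && (pi2 w <? gM m n) &&
    gbad P m n l (pi1 w) (pi1 (st (pi1 w))) (gcoloring P m n l (pi2 (st (pi1 w)))) (pi2 w)).
  { intros w. unfold W, z, st. cbv zeta. rewrite ?pi2_cpair. unfold params.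
    rewrite ?pi2_cpair, ?pi1_cpair, ?pi2_cpair, ?pi1_cpair, ?pi2_cpair, ?pi1_cpair.
    reflexivity. }
  apply (HC nil (str_pair a b) (params m n l g) u (m + n + 2 - g)
    (cpair t (point n a b))); auto.
  - intros ks Hd Hi. apply (enumeration_size (gM m n) _ (fun t' w =>
      gbad P m n l (t + t') (pi1 (st t)) (gcoloring P m n l (pi2 (st t))) w)); auto.
    + intros t' t'' i L. apply gbad_mono. lia.
    + intros t'. apply Nat.lt_le_incl. apply gstage_last; [lia|]. apply Hlast. lia.
    + intros i Hin. destruct (Hi i Hin) as (w & Hw & <-). fold z in Hw. rewrite EW in Hw.
      apply andb_true_iff in Hw as [Hw H3]. apply andb_true_iff in Hw as [H1 H2].
      apply Nat.ltb_lt in H2. split; auto. exists (pi1 w).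
      assert (E : pi1 (st (pi1 w)) = pi1 (st t)).
      { apply Nat.le_antisymm; auto. apply Nat.nlt_ge. intros L.
        apply negb_true_iff in H1. rewrite (proj2 (Ho' _)) in H1; [discriminate|eauto]. }
      apply gstage_eq in E. fold (st (pi1 w)) (st t) in E. rewrite E in H3.
      revert H3. apply gbad_mono. lia.
  - fold z. rewrite EW, pi1_cpair, pi2_cpair, Hbad.
    rewrite (proj2 (Nat.ltb_lt _ _) (point_lt m n a b Ha Hb)), !andb_true_r.
    apply negb_true_iff, not_true_is_false. rewrite Ho'. intros [t' Ht'].
    specialize (Hmax t'). lia.
  - unfold params. rewrite !pi2_cpair, pi1_cpair, xof_ab, yof_ab by auto. apply spair_code.
Qed.
End Descriptions.

(** * The bounds in integer form *)

Lemma KSc_le (U : cdecomp) x y k :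
  (exists q, U q y x /\ length q <= k) -> KSc U x y <= k.
Proof.
  intros (q & Hq & L). etransitivity; [|exact L]. now apply (KSc_spec U q y x Hq).
Qed.

Lemma main_bounds U V A : optimal no_oracle U -> optimal halting_set V ->
  exists C, forall m n l e a b,
  n + 4 <= m -> 3 <= e -> m < 2 ^ e -> l < 2 ^ e -> length a = m -> length b = n ->
  m + n < KS V (str_pair a b) + A * e ->
  exists c,
    n + l <= KS U c + C * e /\ KS U c <= n + l + C * e /\
    KSc U c b <= KS U c + C * e /\ KS U c <= KSc U c b + C * e /\
    KSc U b (str_pair a c) <= C * e /\
    forall f, KS U f + KSc U b (str_pair a f) <= l ->
      KSc U b (str_pair c f) <= m - n + KSc U b (str_pair a f) + C * e.
Proof.
  intros HU HV.
  destruct (optimal_program U HU) as [P HP].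
  destruct (optimal_total _ U HU) as [c0 Hc0].
  destruct (KSc_le_KS U HU) as [c1 Hc1].
  destruct (second_given_first P _ U HU) as [c2 Hc2].
  destruct (second_given_helper P _ U HU) as [c3 Hc3].
  destruct (bad_pair_description P V HV) as [c4 Hc4].
  assert (Hatt : forall x y, exists p, U p y x /\ length p = KSc U x y).
  { intros x y. destruct (Hc0 x y) as (q & Hq & _). apply (KSc_spec U q y x Hq). }
  (* The bad set has density [2^-g] with [g = 2^b0 * e]; [b0] is chosen so that [g]
     exceeds the cost of all the parameters. *)
  set (b0 := A + 50 + c4).
  (* The left side, times [e], dominates [A * e] for the randomness deficiency, [16 * (e + b0) + 28]
     for the parameters, 2 for the size of the point set, and [c4]; thus 46 = 16 + 28 + 2. The cost
     of naming [g] is linear in [b0] while [g] is exponential in it. *)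
  assert (Hb0 : A + 16 * b0 + 46 + c4 <= 2 ^ b0).
  { unfold b0. replace (A + 50 + c4) with (A + c4 + 50) by lia. rewrite Nat.pow_add_r.
    assert (A + c4 < 2 ^ (A + c4)) by (apply Nat.pow_gt_lin_r; lia).
    assert (2 ^ 10 <= 2 ^ 50) by (apply Nat.pow_le_mono_r; lia).
    change (2 ^ 10) with 1024 in *. revert H H0. generalize (2 ^ (A + c4)), (2 ^ 50).
    intros. nia. }
  exists (2 ^ b0 + 4 + c0 + c1 + c2 + c3 + 200 + 32 * b0).
  set (C := 2 ^ b0 + 4 + c0 + c1 + c2 + c3 + 200 + 32 * b0).
  intros m n l e a b Hnm He Hm Hl Ha Hb HK.
  set (g := 2 ^ b0 * e). set (u := e + b0).
  assert (Eu : 2 ^ u = 2 ^ e * 2 ^ b0) by apply Nat.pow_add_r.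
  assert (B0 := pow2_pos b0). assert (Be : e < 2 ^ e) by (apply Nat.pow_gt_lin_r; lia).
  assert (Hu : params m n l g < 2 ^ (8 * u + 14)).
  { apply params_lt; rewrite Eu; unfold g; nia. }
  assert (grow : forall x, x <= x * e) by (intros; nia).
  assert (HCe : C * e = g + 4 * e + c0 * e + c1 * e + c2 * e + c3 * e + 200 * e
    + 32 * (b0 * e)) by (unfold C, g; lia).
  assert (X0 := grow c0). assert (X1 := grow c1). assert (X2 := grow c2).
  assert (X3 := grow c3). assert (Xb := grow b0).
  assert (Cg : g + 4 * e + c0 + c1 <= C * e) by lia.
  set (st := gstage P m n l g).
  destruct (monotone_bounded_stabilizes (fun t => pi1 (st t)) (2 ^ (l + g + 4 * e)))
    as [t Hlast].
  { intros; now apply gstage_mono. }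
  { intros. apply Nat.lt_le_incl. now apply gstage_lt. }
  set (s := pi1 (st t)) in *. set (h := gcoloring P m n l (pi2 (st t))).
  set (w := point n a b). set (i := color (2 ^ n) h w).
  assert (Hi : i < 2 ^ n) by (apply color_lt, pow2_pos).
  assert (Hw : w < gM m n) by now apply point_lt.
  assert (Hgood : forall t', gbad P m n l t' s h w = false).
  { intros t'. apply not_true_is_false. intros Hbad.
    apply (gbad_mono _ _ _ _ t' (Nat.max t t')) in Hbad; [|lia].
    set (t1 := Nat.max t t') in *.
    assert (E1 : st t1 = st t) by (apply gstage_eq, Hlast; lia).
    assert (Hlt : cnt (gM m n) (gbad P m n l t1 s h) < gE m n g).
    { apply gstage_last; [lia|]. apply Hlast. lia. }
    (* For larger [g] the threshold would be 1 and no point could be bad; so the subtraction in the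
       next bound is not truncated and really saves [g] bits. *)
    assert (Hg : g < m + n + 2).
    { apply Nat.nle_gt. intros Hg. unfold gE in Hlt.
      replace (m + n + 2 - g) with 0 in Hlt by lia.
      assert (H := sumn_term _ (fun w => Nat.b2n (gbad P m n l t1 s h w)) w Hw).
      cbv beta in H. rewrite Hbad in H. unfold cnt in Hlt. simpl in H, Hlt. lia. }
    assert (KS V (str_pair a b) <= (m + n + 2 - g) + 2 * (8 * u + 14) + c4).
    { unfold KS. apply KSc_le. apply (Hc4 m n l g a b t1 (8 * u + 14)); auto.
      - intros t2 L2. fold st. rewrite E1. apply Hlast. lia.
      - fold st. rewrite E1. exact Hbad. }
    assert (Hg' := Nat.mul_le_mono_r _ _ e Hb0). fold g in Hg'.
    assert (X4 := grow c4). unfold u in H. lia. }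
  destruct (str_code_surj (s * 2 ^ n + i)) as [c Hc].
  assert (Hcd : str_code c / 2 ^ n = s).
  { rewrite Hc, Nat.div_add_l, Nat.div_small by lia. lia. }
  assert (Hcm : str_code c mod 2 ^ n = i).
  { rewrite Hc, Nat.add_comm, Nat.Div0.mod_add. now apply Nat.mod_small. }
  assert (Hcd' : pi1 (gstage P m n l g t) = str_code c / 2 ^ n) by exact (eq_sym Hcd).
  assert (Hcm' : color (2 ^ n) (gcoloring P m n l (pi2 (gstage P m n l g t))) (point n a b)
    = str_code c mod 2 ^ n) by exact (eq_sym Hcm).
  assert (Hs : s < 2 ^ (l + g + 4 * e)) by now apply gstage_lt.
  assert (Lc : length c <= n + l + g + 4 * e).
  { apply str_length_le. rewrite Hc.
    assert (E : 2 ^ S (n + l + g + 4 * e) = 2 * (2 ^ (l + g + 4 * e) * 2 ^ n)).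
    { rewrite Nat.pow_succ_r', <- Nat.pow_add_r. do 2 f_equal. lia. }
    rewrite E. assert (H := Nat.mul_le_mono_r _ _ (2 ^ n) Hs).
    assert (H' := Nat.le_0_l (s * 2 ^ n)). lia. }
  (* The lower bound is obtained given b, the condition attached to the point; the plain one follows
     because a condition increases complexity by at most [c1]. *)
  assert (Hlow : n + l <= KSc U c b).
  { destruct (Hatt c b) as (p & Hp & <-). apply Nat.nlt_ge. intros L.
    apply HP in Hp as [t' Ht']. specialize (Hgood t').
    unfold gbad, bad in Hgood. apply orb_false_iff in Hgood as [_ Hgood].
    unfold compressed in Hgood. rewrite exb_false in Hgood.
    assert (Lp := str_code_length p).
    assert (2 ^ S (length p) <= 2 ^ (n + l)) by (apply Nat.pow_le_mono_r; lia).
    specialize (Hgood (str_code p) ltac:(lia)).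
    unfold w in Hgood. rewrite yof_ab, Ht' in Hgood by auto. fold w i in Hgood.
    rewrite Hc, Nat.eqb_refl in Hgood. discriminate. }
  assert (Hup : forall y, KSc U c y <= n + l + g + 4 * e + c0).
  { intros y. apply KSc_le. destruct (Hc0 c y) as (q & Hq & L). exists q. split; auto. lia. }
  assert (Hup0 := Hup nil). fold (KS U c) in Hup0. assert (Hupb := Hup b).
  assert (Hcond := Hc1 c b).
  assert (HgL : gL m n l + 4 <= 2 ^ (e + 3)).
  { unfold gL. rewrite Nat.pow_add_r. change (2 ^ 3) with 8. lia. }
  exists c. repeat split; try lia.
  - etransitivity; [apply KSc_le, (Hc2 m n l g a b c t (e + 3) (8 * u + 14)); auto|].
    + lia.
    + rewrite HCe. unfold u. lia.
  - intros f Hf. set (k := KSc U b (str_pair a f)) in *.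
    destruct (Hatt f nil) as (p & Hp & Ep). fold (KS U f) in Ep.
    destruct (Hatt b (str_pair a f)) as (q & Hq & Eq). fold k in Eq.
    apply HP in Hp as [t1 Ht1]. apply HP in Hq as [t2 Ht2]. simpl str_code in Ht1.
    rewrite <- spair_code in Ht2.
    assert (Lp : str_code p < 2 ^ (l + 1)) by (rewrite Nat.add_1_r; apply str_code_lt; lia).
    assert (Lq : str_code q < 2 ^ (k + 1)) by (rewrite Nat.add_1_r; apply str_code_lt; lia).
    etransitivity;
      [apply KSc_le, (Hc3 m n l g a b c f t t2 k (m - n + k + e + 5) (2 * (8 * u + 14) + 2));
       auto|].
    + unfold related. apply exbP. exists (str_code q). split; auto.
      rewrite xof_ab, yof_ab by auto. now apply Nat.eqb_eq.
    + intros t'. fold st h. rewrite Hcm.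
      assert (Lp' : str_code p < 2 ^ (m + l + 1)).
      { assert (2 ^ (l + 1) <= 2 ^ (m + l + 1)) by (apply Nat.pow_le_mono_r; lia). lia. }
      destruct (test_index m l k (str_code p) Lp') as [E1 E2].
      assert (Hj := test_index_lt m l k (str_code p) Lp' ltac:(lia)).
      set (j := k * 2 ^ (m + l + 1) + str_code p) in *.
      (* The test is empty until [p] has halted, so it is examined at a time when [p] is done and
         the enumeration has got as far as [t']. *)
      set (t3 := Nat.max t1 t').
      specialize (Hgood t3). unfold gbad, bad in Hgood.
      apply orb_false_iff in Hgood as [Hgood _]. unfold killed in Hgood.
      rewrite exb_false in Hgood. specialize (Hgood j Hj). apply Nat.ltb_ge in Hgood.
      fold i in Hgood. unfold weight in Hgood. rewrite E1 in Hgood.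
      rewrite (proj2 (Nat.leb_le k l)) in Hgood by lia.
      transitivity (gL m n l + 3 * 2 ^ (m - n + k + 2)).
      * etransitivity; [|exact Hgood]. apply cnt_mono. intros w' _ Hw'.
        apply andb_true_iff in Hw' as [H1 H2]. apply andb_true_iff. split; auto.
        unfold test. rewrite E1, E2, (proj2 (Nat.leb_le k l)), (proj2 (Nat.ltb_lt _ _) Lp)
          by lia.
        rewrite (ueval_mono P t1 t3 _ _ _ ltac:(lia) Ht1). simpl.
        apply (related_mono P n t' t3); auto. lia.
      (* The factor [2 ^ (e + 3)] absorbs both the slack [gL] and the 3 of the overfull
         threshold. *)
      * replace (m - n + k + e + 5) with ((m - n + k + 2) + (e + 3)) by lia.
        rewrite (Nat.pow_add_r 2 (m - n + k + 2)).
        assert (G1 : 2 ^ 1 <= 2 ^ (m - n + k + 2)) by (apply Nat.pow_le_mono_r; lia).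
        assert (G2 : 2 ^ 3 <= 2 ^ (e + 3)) by (apply Nat.pow_le_mono_r; lia).
        assert (G3 : gL m n l <= 2 ^ (e + 3)) by lia.
        change (2 ^ 1) with 2 in G1. change (2 ^ 3) with 8 in G2.
        revert G1 G2 G3. generalize (2 ^ (m - n + k + 2)), (2 ^ (e + 3)), (gL m n l).
        clear. intros. nia.
    + apply cpair_lt; auto.
      apply Nat.lt_trans with (2 ^ e); [lia|]. apply Nat.pow_lt_mono_r; unfold u; lia.
    + rewrite HCe. unfold u. lia.
Qed.

(** * Passage to real logarithms *)

Open Scope R_scope.

Lemma log2_le x e : (1 <= x)%nat -> (x <= 2 ^ e)%nat -> log2 (INR x) <= INR e.
Proof.
  intros H1 H2. unfold log2.
  assert (L2 : 0 < ln 2) by (rewrite <- ln_1; apply ln_increasing; lra).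
  apply Rmult_le_reg_r with (ln 2); auto. unfold Rdiv.
  rewrite Rmult_assoc, Rinv_l, Rmult_1_r, <- ln_pow by lra.
  assert (Hx : 0 < INR x) by (apply lt_0_INR; lia).
  assert (Hle : INR x <= 2 ^ e).
  { apply le_INR in H2. now rewrite pow_INR in H2. }
  destruct Hle as [Hlt| ->]; [|lra]. left. now apply ln_increasing.
Qed.

Lemma le_log2 x e : (2 ^ e <= x)%nat -> INR e <= log2 (INR x).
Proof.
  intros H. unfold log2.
  assert (L2 : 0 < ln 2) by (rewrite <- ln_1; apply ln_increasing; lra).
  apply Rmult_le_reg_r with (ln 2); auto. unfold Rdiv.
  rewrite Rmult_assoc, Rinv_l, Rmult_1_r, <- ln_pow by lra.
  assert (Hle : 2 ^ e <= INR x).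
  { apply le_INR in H. now rewrite pow_INR in H. }
  assert (0 < 2 ^ e) by (apply pow_lt; lra).
  destruct Hle as [Hlt| <-]; [|lra]. left. now apply ln_increasing.
Qed.

Theorem theorem5
  (U : cdecomp) (HU : optimal no_oracle U)
  (V : cdecomp) (HV : optimal halting_set V)
  (alpha : R) (Halpha : 0 < alpha) :
  exists C : R,
  forall (m n l : nat),
    (1 <= m)%nat -> (1 <= n)%nat -> (1 <= l)%nat ->
    (n + 4 <= m)%nat ->
    INR m - alpha * log2 (INR m) >= INR n + 2 ->
    INR l + 1 + log2 (INR (l + 1)) <= 2 ^ (m - n - 2) ->
    forall a b : list bool,
      length a = m -> length b = n ->
      INR m + INR n - INR (KS V (str_pair a b)) < alpha * log2 (INR m) ->
      let N := Nat.max m l in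
      exists c : list bool,
        Rabs (INR (KS U c) - INR (n + l)) <= C * log2 (INR N) /\
        Rabs (INR (KSc U c b) - INR (KS U c)) <= C * log2 (INR N) /\
        INR (KSc U b (str_pair a c)) <= C * log2 (INR N) /\
        (forall f : list bool,
           INR (KS U f) <= INR l - INR (KSc U b (str_pair a f)) ->
           INR (KSc U b (str_pair c f))
             <= INR m - INR n + INR (KSc U b (str_pair a f)) + C * log2 (INR N)).
Proof.
  destruct (INR_archimed 1 alpha) as [A HA]; [lra|]. rewrite Rmult_1_r in HA.
  destruct (main_bounds U V A HU HV) as [C HC].
  (* The factor 2 pays for rounding: [e] is the integer part of log N plus 1, at most 2 log N. *)
  exists (2 * INR C). intros m n l Hm1 Hn1 Hl1 Hnm _ _ a b Ha Hb HK N.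
  set (e := S (Nat.log2 N)).
  assert (HN := Nat.log2_spec N ltac:(lia)). fold e in HN.
  (* From [1 <= n] and [n + 4 <= m] one has N >= 5, whose integer logarithm is at least 2. *)
  assert (He : (3 <= e)%nat).
  { unfold e. change 3%nat with (S (Nat.log2 5)) at 1.
    apply le_n_S, Nat.log2_le_mono. lia. }
  assert (Hlog : INR e <= 2 * log2 (INR N)).
  { assert (L := le_log2 N (Nat.log2 N) ltac:(lia)).
    unfold e. rewrite S_INR.
    assert (1 <= INR (Nat.log2 N)) by (apply (le_INR 1); unfold e in He; lia). lra. }
  assert (HCe : INR (C * e) <= 2 * INR C * log2 (INR N)).
  { rewrite mult_INR. assert (P := pos_INR C).
    apply (Rmult_le_compat_l (INR C)) in Hlog; lra. }
  destruct (HC m n l e a b) as (c & H1 & H2 & H3 & H4 & H5 & H6); try lia.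
  { apply INR_lt. rewrite !plus_INR, mult_INR.
    assert (L := log2_le m e Hm1 ltac:(lia)).
    assert (P : 0 <= INR e) by apply pos_INR.
    assert (alpha * log2 (INR m) <= alpha * INR e) by (apply Rmult_le_compat_l; lra).
    assert (alpha * INR e <= INR A * INR e) by (apply Rmult_le_compat_r; lra). lra. }
  apply le_INR in H1, H2, H3, H4, H5. do 2 rewrite plus_INR in H1, H2. rewrite plus_INR in H3, H4.
  exists c. repeat split.
  - rewrite plus_INR. apply Rabs_le; split; lra.
  - apply Rabs_le; split; lra.
  - lra.
  - intros f Hf. assert (Hf' : (KS U f + KSc U b (str_pair a f) <= l)%nat).
    { apply INR_le. rewrite plus_INR. lra. }
    specialize (H6 f Hf'). apply le_INR in H6.
    rewrite !plus_INR, minus_INR in H6 by lia. lra.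
Qed.
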